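(* (a) Let $A$ and $B$ be $1$-graphs with $A^0=B^0=V$ whose vertex matrices commute, and let $\theta:A^1*B^1\to B^1*A^1$, $(\alpha,\beta)\mapsto(\beta',\alpha')$, be a bijection such that $r(\alpha)=r(\beta')$ and $s(\beta)=s(\alpha')$. Let $\Lambda=A*_\theta B$ be the collection of grids described in the context. If $(v,\alpha,\beta)\in\Lambda^{(m,n)}$ and $(v',\alpha',\beta')\in\Lambda^{(m',n')}$ satisfy $v(m,n)=v'(0,0)$, then there is a unique $(v'',\alpha'',\beta'')\in\Lambda^{(m+m',n+n')}$ such that $v''(i,j)=v(i,j)$, $\alpha''(i,j)=\alpha(i,j)$, $\beta''(i,j)=\beta(i,j)$, $v''(m+i,n+j)=v'(i,j)$, $\alpha''(m+i,n+j)=\alpha'(i,j)$ and $\beta''(m+i,n+j)=\beta'(i,j)$ wherever these formulas make sense. With this element as the composite $(v,\alpha,\beta)(v',\alpha',\beta')$, $\Lambda=A*_\theta B$ is a $2$-graph. (b) Up to isomorphism, every $2$-graph is obtained in this way from its constituent (coordinate) $1$-graphs: every $2$-graph $\Lambda$ is isomorphic to $A*_\theta B$, where $A$ and $B$ are its two coordinate graphs, for some such bijection $\theta$.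
   Context: Let $\mathbf{N}=\{0,1,2,\dots\}$, $k\ge 1$, and order $\mathbf{N}^k$ coordinatewise. A $k$-graph $(\Lambda,d)$ is a countable small category $\Lambda$ (range map $r$, source map $s$) with a functor $d:\Lambda\to\mathbf{N}^k$ satisfying the factorisation property: if $d(\lambda)=m+n$ there are unique $\mu,\nu\in\Lambda$ with $\lambda=\mu\nu$, $d(\mu)=m$, $d(\nu)=n$. $\lambda\mu$ is defined iff $s(\lambda)=r(\mu)$. Put $\Lambda^n=d^{-1}(n)$; $\Lambda^0$ is identified with the set of objects. Standing assumption: $0<\#\{\lambda\in\Lambda^n:r(\lambda)=v\}<\infty$ for all $v\in\Lambda^0$, $n\in\mathbf{N}^k$. Morphisms of $k$-graphs are degree-preserving functors. The vertex matrix of a $1$-graph $A$ is $M_A(u,v)=\#\{\lambda\in A^1:r(\lambda)=u,\ s(\lambda)=v\}$. Put $A^1*B^1=\{(\alpha,\beta)\in A^1\times B^1:s(\alpha)=r(\beta)\}$ and $B^1*A^1=\{(\beta,\alpha)\in B^1\times A^1:s(\beta)=r(\alpha)\}$. Commutation of the vertex matrices guarantees the existence of bijections $\theta$ as in (a). For $(m,n)\in\mathbf{N}^2$ let $W(m,n)=\{(i,j)\in\mathbf{N}^2:(i,j)\le(m,n)\}$, and $W(m,n)=\emptyset$ if $m$ or $n$ is negative. An element of $\Lambda^{(m,n)}$, written $(v,\alpha,\beta)$, consists of $v(i,j)\in V$ for $(i,j)\in W(m,n)$, $\alpha(i,j)\in A^1$ for $(i,j)\in W(m-1,n)$ and $\beta(i,j)\in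 B^1$ for $(i,j)\in W(m,n-1)$, such that, wherever these make sense: $r(\alpha(i,j))=v(i,j)$ and $r(\beta(i,j))=v(i,j)$; $s(\alpha(i,j))=v(i+1,j)$ and $s(\beta(i,j))=v(i,j+1)$; $\theta(\alpha(i,j),\beta(i+1,j))=(\beta(i,j),\alpha(i,j+1))$. $\Lambda=\bigcup_{(m,n)}\Lambda^{(m,n)}$, with degree $(m,n)$ on $\Lambda^{(m,n)}$, $\Lambda^{(0,0)}$ identified with $V$, $s(v,\alpha,\beta)=v(m,n)$ and $r(v,\alpha,\beta)=v(0,0)$. The coordinate graphs of a $2$-graph $\Lambda$ are the $1$-graphs (subcategories) $\Lambda_1=\bigcup_n\Lambda^{(n,0)}$ and $\Lambda_2=\bigcup_n\Lambda^{(0,n)}$, with degree $n$. *)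

(* Defs.v *)
From HB Require Import structures.
From mathcomp Require Import all_boot all_order all_algebra finmap.
From mathcomp Require Import boolp classical_sets functions cardinality fsbigop.

Set Implicit Arguments.
Unset Strict Implicit.
Unset Printing Implicit Defensive.

Import GRing.Theory.
Local Open Scope classical_set_scope.
Local Open Scope ring_scope.

(* Raw data of a k-graph with object set [V]; countability is carried by the
   two countTypes.  [comp] is total, but [comp x y] is the composite of x and y
   only when [src x = rng y]; its other values are irrelevant. *)
Record kgraph_data (k : nat) (V : countType) := KGraphData {
  mor :> countType;
  rng : mor -> V;
  src : mor -> V;
  idm : V -> mor;
  comp : mor -> mor -> mor;
  deg : mor -> {ffun 'I_k -> nat}
}.

Arguments rng {k V L} : rename.
Arguments src {k V L} : rename.
Arguments idm {k V L} : rename.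
Arguments comp {k V L} : rename.
Arguments deg {k V L} : rename.

Record is_kgraph (k : nat) (V : countType) (L : kgraph_data k V) : Prop :=
  IsKGraph {
  rank_gt0 : (0 < k)%N;
  rng_idm : forall v : V, rng (idm v : L) = v;
  src_idm : forall v : V, src (idm v : L) = v;
  rng_comp : forall x y : L, src x = rng y -> rng (comp x y) = rng x;
  src_comp : forall x y : L, src x = rng y -> src (comp x y) = src y;
  comp_idml : forall x : L, comp (idm (rng x)) x = x;
  comp_idmr : forall x : L, comp x (idm (src x)) = x;
  comp_assoc : forall x y z : L, src x = rng y -> src y = rng z ->
    comp x (comp y z) = comp (comp x y) z;
  deg_idm : forall v : V, deg (idm v : L) = 0;
  deg_comp : forall x y : L, src x = rng y -> deg (comp x y) = deg x + deg y;
  factorisation : forall (l : L) (m n : {ffun 'I_k -> nat}),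
    deg l = m + n ->
    exists! p : L * L, [/\ src p.1 = rng p.2, l = comp p.1 p.2,
                           deg p.1 = m & deg p.2 = n];
  paths_neq0 : forall (v : V) (n : {ffun 'I_k -> nat}),
    [set l : L | deg l = n /\ rng l = v] !=set0;
  paths_finite : forall (v : V) (n : {ffun 'I_k -> nat}),
    finite_set [set l : L | deg l = n /\ rng l = v]
}.

Record kgraph (k : nat) (V : countType) := KGraph {
  kgraph_dataOf :> kgraph_data k V;
  kgraphP : is_kgraph kgraph_dataOf
}.

Definition deg1 (n : nat) : {ffun 'I_1 -> nat} := [ffun=> n].

Definition deg2 (m n : nat) : {ffun 'I_2 -> nat} :=
  [ffun i => if i == ord0 then m else n].

Record is_morphism (k : nat) (V V' : countType)
    (L : kgraph_data k V) (L' : kgraph_data k V')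
    (f0 : V -> V') (f : L -> L') : Prop := IsMorphism {
  morph_rng : forall x, rng (f x) = f0 (rng x);
  morph_src : forall x, src (f x) = f0 (src x);
  morph_idm : forall v, f (idm v) = idm (f0 v);
  morph_comp : forall x y, src x = rng y -> f (comp x y) = comp (f x) (f y);
  morph_deg : forall x, deg (f x) = deg x
}.

Definition isomorphic (k : nat) (V V' : countType)
    (L : kgraph_data k V) (L' : kgraph_data k V') : Prop :=
  exists (f0 : V -> V') (f : L -> L') (g0 : V' -> V) (g : L' -> L),
    [/\ is_morphism f0 f, is_morphism g0 g,
        cancel f0 g0 /\ cancel g0 f0 & cancel f g /\ cancel g f].

Definition vertex_matrix (V : countType) (A : kgraph_data 1 V) (u v : V) : nat :=
  #|` fset_set [set l : A | [/\ deg l = deg1 1, rng l = u & src l = v]] |%N.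

(* For 1-graphs the rows of the vertex matrices are finitely supported, so the
   sums below are the entries of the two matrix products. *)
Definition vertex_matrices_commute (V : countType) (A B : kgraph_data 1 V) : Prop :=
  forall u w : V,
    \sum_(v \in [set: V]) (vertex_matrix A u v * vertex_matrix B v w)%N =
    \sum_(v \in [set: V]) (vertex_matrix B u v * vertex_matrix A v w)%N.

Definition edge_pairs (V : countType) (A B : kgraph_data 1 V) : set (A * B) :=
  [set p | [/\ deg p.1 = deg1 1, deg p.2 = deg1 1 & src p.1 = rng p.2]].

Arguments edge_pairs {V} A B _.

(* A bijection A^1 * B^1 -> B^1 * A^1 preserving the range and source of the
   pairs; only the restriction of [theta] to [edge_pairs A B] matters. *)
Definition is_edge_exchange (V : countType) (A B : kgraph_data 1 V)
    (theta : A * B -> B * A) : Prop :=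
  set_bij (edge_pairs A B) (edge_pairs B A) theta /\
  forall p, edge_pairs A B p ->
    rng p.1 = rng (theta p).1 /\ src p.2 = src (theta p).2.

(* The indices i and i + 1 in {0, ..., m}, for i < m. *)
Definition lo m (i : 'I_m) : 'I_m.+1 := widen_ord (leqnSn m) i.
Definition hi m (i : 'I_m) : 'I_m.+1 := lift ord0 i.

Section ThetaProduct.
Variables (V : countType) (A B : kgraph_data 1 V) (theta : A * B -> B * A).

(* A function on W(m, n) is an m.+1 x n.+1 matrix, one on W(m - 1, n) is an
   m x n.+1 matrix, and one on W(m, n - 1) is an m.+1 x n matrix. *)
Definition is_grid m n
    (x : 'M[V]_(m.+1, n.+1) * 'M[A]_(m, n.+1) * 'M[B]_(m.+1, n)) : bool :=
  let: (v, a, b) := x in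
  [&& [forall i, forall j, [&& deg (a i j) == deg1 1,
         rng (a i j) == v (lo i) j & src (a i j) == v (hi i) j]],
      [forall i, forall j, [&& deg (b i j) == deg1 1,
         rng (b i j) == v i (lo j) & src (b i j) == v i (hi j)]] &
      [forall i, forall j,
         theta (a i (lo j), b (hi i) j) == (b (lo i) j, a i (hi j))]].

Definition grid m n := {x | @is_grid m n x}.

Definition gridv m n (x : grid m n) : 'M[V]_(m.+1, n.+1) := (val x).1.1.
Definition grida m n (x : grid m n) : 'M[A]_(m, n.+1) := (val x).1.2.
Definition gridb m n (x : grid m n) : 'M[B]_(m.+1, n) := (val x).2.

(* [Y (p + i) (q + j) = X i j] whenever both sides make sense. *)
Definition agrees_at (T : Type) (p q a b a' b' : nat)
    (Y : 'M[T]_(a', b')) (X : 'M[T]_(a, b)) : Prop :=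
  forall (i : 'I_a) (j : 'I_b) (i' : 'I_a') (j' : 'I_b'),
    i' = (p + i)%N :> nat -> j' = (q + j)%N :> nat -> Y i' j' = X i j.

Definition is_concat m n m' n'
    (x : grid m n) (x' : grid m' n') (y : grid (m + m') (n + n')) : Prop :=
  [/\ agrees_at 0 0 (gridv y) (gridv x),
      agrees_at 0 0 (grida y) (grida x) &
      agrees_at 0 0 (gridb y) (gridb x)] /\
  [/\ agrees_at m n (gridv y) (gridv x'),
      agrees_at m n (grida y) (grida x') &
      agrees_at m n (gridb y) (gridb x')].

Definition path2 := {mn : nat * nat & grid mn.1 mn.2}.

Definition mk_path2 m n (x : grid m n) : path2 :=
  existT (fun mn : nat * nat => grid mn.1 mn.2) (m, n) x.

(* The matrices of edges are empty here; their entries are placeholders. *)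
Lemma is_grid_vertex (v : V) :
  @is_grid 0 0 (const_mx v, const_mx (idm v), const_mx (idm v)).
Proof.
apply/and3P; split; first by apply/forallP => -[].
- by apply/forallP => i; apply/forallP => -[].
by apply/forallP => -[].
Qed.

Definition grid_vertex (v : V) : grid 0 0 := Sub _ (is_grid_vertex v).

(* The concatenation of x and y if there is one, and x otherwise. *)
Definition path2_comp (x y : path2) : path2 :=
  xget x [set mk_path2 z | z in is_concat (tagged x) (tagged y)].

Definition theta_product : kgraph_data 2 V :=
  @KGraphData 2 V path2
    (fun x => gridv (tagged x) ord0 ord0)
    (fun x => gridv (tagged x) ord_max ord_max)
    (fun v => mk_path2 (grid_vertex v))
    path2_comp
    (fun x => deg2 (tag x).1 (tag x).2).

End ThetaProduct.

Section CoordinateGraph.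
Variables (V : countType) (L : kgraph 2 V) (c : 'I_2).

Definition on_axis (l : L) : bool := [forall i, (i != c) ==> (deg l i == 0%N)].

Definition axis_mor := {l : L | on_axis l}.

Lemma on_axis_idm (v : V) : on_axis (idm v).
Proof.
by apply/forallP => i; rewrite (deg_idm (kgraphP L)) ffunE eqxx implybT.
Qed.

(* The subcategory of paths whose degree is supported on the c-th axis; the
   composite of composable elements of [axis_mor] again lies on the axis, so
   the default value of [insubd] is only reached on non-composable pairs. *)
Definition coordinate_graph : kgraph_data 1 V :=
  @KGraphData 1 V axis_mor
    (fun x => rng (val x))
    (fun x => src (val x))
    (fun v => Sub (idm v) (on_axis_idm v))
    (fun x y => insubd x (comp (val x) (val y)))
    (fun x => deg1 (deg (val x) c)).

End CoordinateGraph.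

(* Main.v *)
Require Import Defs.
From mathcomp Require Import all_boot all_order all_algebra.
From mathcomp Require Import boolp classical_sets.
From mathcomp Require Import finmap functions cardinality fsbigop zify.
Import Defs GRing.Theory.

(** The exchange [theta] completes the bottom and right edges of a unit square
    to a commuting square in exactly one way, and its inverse completes the
    left and top edges in exactly one way.  Completing one square at a time,
    row after row, a bottom row and a right column of edges determine a whole
    rectangle of squares, and so do a left column and a top row ([fill_ul],
    [fill_ul_uniq], [fill_lr], [fill_lr_uniq]).  When two grids meet at a
    corner, the two missing rectangles of the enclosing grid are each given by
    two such sides, so the concatenation exists and is unique
    ([concat_tiling], [concat_tiling_uniq]).  All category axioms then follow
    from this uniqueness, because both sides of an equation concatenate the same
    pieces; factorising a grid is cutting it into a lower left and an upper
    right part.  The finiteness and nonemptiness of the sets of paths need only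
    be checked on edges, since every path is a product of edges
    ([kgraph_from_edges]); the edges of the grid category are those of [A] and
    [B].

    Conversely, in a 2-graph an edge of degree (1, 0) followed by an edge of
    degree (0, 1) is a path of degree (1, 1), which factors uniquely in the
    other order; this defines the exchange [swap]. A bijection that preserves
    the ends of pairs of edges forces the vertex matrices to commute, as both
    products count such pairs ([edge_exchange_commute]). A path [l] of degree
    (m, n) has, at each position, a unique segment of each degree that fits
    in, and its segments of degree (0, 0), (1, 0) and (0, 1) form a grid
    ([trace_ex]). Taking this grid is a functor, since the segments of a
    product include those of its factors ([trace_comp]), and it is bijective
    on edges. A degree-preserving functor that is the identity on objects and
    bijective on edges is an isomorphism, by factorising paths into edges on
    both sides ([isomorphic_from_edges]). *)

Set Implicit Arguments.
Unset Strict Implicit.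
Unset Printing Implicit Defensive.

(** * Tilings by commuting squares *)

(** Horizontal and vertical edges, and unit squares [square a b b' a'] with
    bottom edge [a], right edge [b], left edge [b'] and top edge [a'].  The
    relation [horE u a w] says that [a] has range [u] and source [w]; positions
    increase from range to source.  The last four axioms say that a square is
    determined by its lower right half, and by its upper left half, and that
    both halves can be prescribed.  Stating both directions makes the structure
    invariant under exchanging the two kinds of edges. *)
Record squares (V : Type) := Squares {
  hor : Type;
  ver : Type;
  horE : V -> hor -> V -> Prop;
  verE : V -> ver -> V -> Prop;
  square : hor -> ver -> ver -> hor -> Prop;
  horE_ends : forall u a w u' w', horE u a w -> horE u' a w' -> u = u' /\ w = w';
  verE_ends : forall u b w u' w', verE u b w -> verE u' b w' -> u = u' /\ w = w';
  square_ul : forall u a v b w, horE u a v -> verE v b w ->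
    exists v' b' a', [/\ verE u b' v', horE v' a' w & square a b b' a'];
  square_lr : forall u b' v' a' w, verE u b' v' -> horE v' a' w ->
    exists v a b, [/\ horE u a v, verE v b w & square a b b' a'];
  square_ul_uniq : forall a b b1 a1 b2 a2,
    square a b b1 a1 -> square a b b2 a2 -> b1 = b2 /\ a1 = a2;
  square_lr_uniq : forall a1 b1 a2 b2 b' a',
    square a1 b1 b' a' -> square a2 b2 b' a' -> a1 = a2 /\ b1 = b2
}.

(** Reflection along the diagonal; it halves the number of proofs about
    rectangles. *)
Definition flip V (X : squares V) : squares V.
Proof.
apply: (@Squares V (ver X) (hor X) (@verE V X) (@horE V X)
          (fun b' a' a b => square a b b' a')).
- exact: verE_ends.
- exact: horE_ends.
- by move=> *; apply: square_lr; eassumption.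
- by move=> *; apply: square_ul; eassumption.
- by move=> b' a' a1 b1 a2 b2; apply: square_lr_uniq.
- by move=> b1 a1 b2 a2 a b; apply: square_ul_uniq.
Defined.

Section Tilings.
Variable V : Type.

(** Total functions stand for partial labellings of the quarter plane: only
    the values inside a given rectangle matter, see [tiles] and [agree].  This
    makes restriction and translation free of casts between matrix sizes. *)
Record tiling (X : squares V) := Tiling {
  tv : nat -> nat -> V;
  ta : nat -> nat -> hor X;
  tb : nat -> nat -> ver X
}.

Implicit Types X : squares V.

Definition tiles X m n (t : tiling X) : Prop :=
  [/\ forall i j, i < m -> j <= n -> horE (tv t i j) (ta t i j) (tv t i.+1 j),
      forall i j, i <= m -> j < n -> verE (tv t i j) (tb t i j) (tv t i j.+1) &
      forall i j, i < m -> j < n ->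
        square (ta t i j) (tb t i.+1 j) (tb t i j) (ta t i j.+1)].

Definition agree X m n (s t : tiling X) : Prop :=
  [/\ forall i j, i <= m -> j <= n -> tv s i j = tv t i j,
      forall i j, i < m -> j <= n -> ta s i j = ta t i j &
      forall i j, i <= m -> j < n -> tb s i j = tb t i j].

Definition shift X p q (t : tiling X) : tiling X :=
  Tiling (fun i j => tv t (p + i) (q + j)) (fun i j => ta t (p + i) (q + j))
         (fun i j => tb t (p + i) (q + j)).

Definition transpose X (t : tiling X) : tiling (flip X) :=
  @Tiling (flip X) (fun i j => tv t j i) (fun i j => tb t j i)
          (fun i j => ta t j i).

Definition untranspose X (t : tiling (flip X)) : tiling X :=
  @Tiling X (fun i j => tv t j i) (fun i j => tb t j i) (fun i j => ta t j i).

Lemma agree_sym X m n (s t : tiling X) : agree m n s t -> agree m n t s.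
Proof. by move=> [v a b]; split=> i j im jn; rewrite (v, a, b). Qed.

Lemma agree_trans X m n (s t u : tiling X) :
  agree m n s t -> agree m n t u -> agree m n s u.
Proof.
by move=> [v a b] [v' a' b']; split=> i j im jn;
  [rewrite v ?v' | rewrite a ?a' | rewrite b ?b'].
Qed.

Lemma agree_shift X p q m n m' n' (s t : tiling X) :
  p + m <= m' -> q + n <= n' -> agree m' n' s t ->
  agree m n (shift p q s) (shift p q t).
Proof. by move=> pm qn [v a b]; split=> i j im jn /=; rewrite ?(v, a, b) //; lia. Qed.

Lemma agree_le X m n m' n' (s t : tiling X) :
  m <= m' -> n <= n' -> agree m' n' s t -> agree m n s t.
Proof. by move=> pm qn [v a b]; split=> i j im jn /=; rewrite ?(v, a, b) //; lia. Qed.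

Lemma shiftD X p q p' q' (t : tiling X) :
  shift p q (shift p' q' t) = shift (p' + p) (q' + q) t.
Proof.
by congr Tiling; apply/funext => i; apply/funext => j /=; rewrite !addnA.
Qed.

Lemma agree_shiftD X p q p' q' m n m' n' (s t : tiling X) :
  p' + m <= m' -> q' + n <= n' -> agree m' n' (shift p q s) t ->
  agree m n (shift (p + p') (q + q') s) (shift p' q' t).
Proof. by move=> mm nn /(agree_shift mm nn); rewrite shiftD. Qed.

Lemma shift00 X (t : tiling X) : shift 0 0 t = t.
Proof. by case: t. Qed.

Lemma tiles_shift X p q m n m' n' (t : tiling X) :
  p + m <= m' -> q + n <= n' -> tiles m' n' t -> tiles m n (shift p q t).
Proof.
move=> pm qn [ha hb hs]; split=> i j im jn /=; rewrite ?addnS.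
- by apply: ha; lia.
- by apply: hb; lia.
by apply: hs; lia.
Qed.

Lemma tiles_le X m n m' n' (t : tiling X) :
  m <= m' -> n <= n' -> tiles m' n' t -> tiles m n t.
Proof. by move=> mm nn /(@tiles_shift X 0 0 m n); rewrite shift00; apply. Qed.

Lemma tiles_agree X m n (s t : tiling X) :
  agree m n s t -> tiles m n t -> tiles m n s.
Proof.
move=> [v a b] [ha hb hs]; split=> i j im jn.
- by rewrite !v ?a; try lia; apply: ha.
- by rewrite !v ?b; try lia; apply: hb.
by rewrite !a ?b; try lia; apply: hs.
Qed.

Lemma tiles_transpose X m n (t : tiling X) :
  tiles m n t -> tiles n m (transpose t).
Proof. by move=> [a b s]; split=> i j im jn /=; [exact: b|exact: a|exact: s]. Qed.

Lemma tiles_untranspose X m n (t : tiling (flip X)) :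
  tiles n m t -> tiles m n (untranspose t).
Proof. by move=> [a b s]; split=> i j im jn /=; [exact: b|exact: a|exact: s]. Qed.

Lemma agree_transpose X m n (s t : tiling X) :
  agree m n s t -> agree n m (transpose s) (transpose t).
Proof. by move=> [v a b]; split=> i j im jn /=; [exact: v|exact: b|exact: a]. Qed.

Lemma agree_untranspose X m n (s t : tiling (flip X)) :
  agree n m s t -> agree m n (untranspose s) (untranspose t).
Proof. by move=> [v a b]; split=> i j im jn /=; [exact: v|exact: b|exact: a]. Qed.

Lemma agree_hcat X m m' n (s t : tiling X) :
  agree m n s t -> agree m' n (shift m 0 s) (shift m 0 t) -> agree (m + m') n s t.
Proof.
move=> [v a b] [v' a' b']; split=> i j im jn.
- have [im'|im'] := leqP i m; first exact: v.
  by rewrite -(subnKC (ltnW im')); apply: (v' (i - m) j) => //; lia.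
- have [im'|im'] := ltnP i m; first exact: a.
  by rewrite -(subnKC im'); apply: (a' (i - m) j) => //; lia.
- have [im'|im'] := leqP i m; first exact: b.
  by rewrite -(subnKC (ltnW im')); apply: (b' (i - m) j) => //; lia.
Qed.

Lemma agree_vcat X m n n' (s t : tiling X) :
  agree m n s t -> agree m n' (shift 0 n s) (shift 0 n t) -> agree m (n + n') s t.
Proof.
move=> /agree_transpose st /agree_transpose st'.
by have /agree_untranspose[] := agree_hcat st st'.
Qed.

Lemma hglue X m m' n (s t : tiling X) : tiles m n s -> tiles m' n t ->
  agree 0 n (shift m 0 s) t ->
  exists u, [/\ tiles (m + m') n u, agree m n u s & agree m' n (shift m 0 u) t].
Proof.
move=> [sa sb ss] [ra rb rs] [ev _ eb].
pose u := @Tiling X (fun i j => if i <= m then tv s i j else tv t (i - m) j)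
   (fun i j => if i < m then ta s i j else ta t (i - m) j)
   (fun i j => if i <= m then tb s i j else tb t (i - m) j).
have us : agree m n u s.
  by split=> i j im jn /=; rewrite im.
have ut : agree m' n (shift m 0 u) t.
  split=> i j im jn /=; rewrite ?addKn.
  - case: ifP => // im'; have i0 : i = 0 by lia.
    by rewrite i0; have := ev 0 j isT jn; rewrite /= addn0.
  - by case: ifP => // im'; lia.
  - case: ifP => // im'; have i0 : i = 0 by lia.
    by rewrite i0; have := eb 0 j isT jn; rewrite /= addn0.
exists u; split=> //.
have [usa usb uss] := tiles_agree us (And3 sa sb ss).
have [uta utb uts] := tiles_agree ut (And3 ra rb rs).
split=> i j im jn.
- have [im'|im'] := ltnP i m; first exact: usa.
  have := uta (i - m) j; rewrite /= ?addnS subnKC //; apply=> //; lia.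
- have [im'|im'] := leqP i m; first exact: usb.
  have := utb (i - m) j; rewrite /= subnKC ?(ltnW im') //; apply=> //; lia.
- have [im'|im'] := ltnP i m; first exact: uss.
  have := uts (i - m) j; rewrite /= ?addnS subnKC //; apply=> //; lia.
Qed.

Lemma vglue X m n n' (s t : tiling X) : tiles m n s -> tiles m n' t ->
  agree m 0 (shift 0 n s) t ->
  exists u, [/\ tiles m (n + n') u, agree m n u s & agree m n' (shift 0 n u) t].
Proof.
move=> /tiles_transpose ts /tiles_transpose tt /agree_transpose st.
have [u [tu /agree_untranspose us /agree_untranspose ut]] := hglue ts tt st.
exists (untranspose u); split.
- exact: tiles_untranspose.
- by case: us.
- by case: ut.
Qed.

(** Squares are added from right to left, each having the bottom edge given and
    its right edge on the previous square. *)
Lemma fill_strip X m (s t : tiling X) : tiles m 0 s -> tiles 0 1 t ->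
  tv s m 0 = tv t 0 0 ->
  exists u, [/\ tiles m 1 u, agree m 0 u s & agree 0 1 (shift m 0 u) t].
Proof.
elim: m s => [|m IH] s ts tt e.
  exists t; split=> //.
  by split=> // -[] // [] // _ _; rewrite e.
have [|||u [tu us ut]] := IH (shift 1 0 s) => //.
  exact: tiles_shift ts.
have [sa _ _] := ts; have [_ ub _] := tu; have [uv _ _] := us.
have := ub 0 0 isT isT.
rewrite uv //= => eb; have /= ea := sa 0 0 isT isT.
have [v' [b' [a' [hb ha hs]]]] := square_ul ea eb.
pose c := @Tiling X
  (fun i j => match i, j with 0, 0 => tv s 0 0 | 0, _ => v' | _, 0 => tv s 1 0
                         | _, _ => tv u 0 1 end)
  (fun _ j => if j is 0 then ta s 0 0 else a')
  (fun i _ => if i is 0 then b' else tb u 0 0).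
have tc : tiles 1 1 c.
  by split=> -[|[|i]] [|[|j]].
have cu : agree 0 1 (shift 1 0 c) u.
  by split=> -[|i] [|[|j]] // _ _; rewrite uv.
have [w [tw wc wu]] := hglue tc tu cu; exists w; split=> //.
- apply: (@agree_hcat X 1) => //.
    apply: (@agree_trans _ _ _ _ c); first exact: agree_le wc.
    by split=> -[|[|i]] [].
  by apply: agree_trans us; apply: agree_le wu.
apply: agree_trans ut.
by apply: (@agree_shiftD X 1 0 m 0 0 1 m 1 w u); rewrite ?addn0.
Qed.

(** A bottom row and a right column extend to a rectangle: the strips of
    [fill_strip] are stacked upwards. *)
Lemma fill_ul X m n (s t : tiling X) : tiles m 0 s -> tiles 0 n t ->
  tv s m 0 = tv t 0 0 ->
  exists u, [/\ tiles m n u, agree m 0 u s & agree 0 n (shift m 0 u) t].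
Proof.
elim: n s t => [|n IH] s t ts tt e.
  exists s; split=> //.
  by split=> // -[] // [] // _ _; rewrite -e /= addn0.
have [|u [tu us [uv _ ub]]] := fill_strip ts (tiles_le (leqnn 0) (isT : 1 <= n.+1) tt).
  exact: e.
have [|||w [tw wu wt]] := IH (shift 0 1 u) (shift 0 1 t).
- exact: tiles_shift tu.
- exact: tiles_shift tt.
- by have /= := uv 0 1 isT isT; rewrite addn0.
have [x [tx xu xw]] := vglue tu tw (agree_sym wu).
exists x; split=> //.
  by apply: agree_trans us; apply: agree_le xu.
apply: (@agree_vcat X 0 1 n).
  apply: (@agree_trans _ _ _ _ (shift m 0 u)); last by split.
  by apply: agree_shift xu; rewrite ?addn0.
apply: agree_trans wt.
rewrite shiftD addn0.
by apply: (@agree_shiftD X 0 1 m 0 0 n m n x w); rewrite ?addn0.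
Qed.

(** The mirror image of [fill_ul]: a left column and a top row. *)
Lemma fill_lr X m n (s t : tiling X) : tiles 0 n s -> tiles m 0 t ->
  tv s 0 n = tv t 0 0 ->
  exists u, [/\ tiles m n u, agree 0 n u s & agree m 0 (shift 0 n u) t].
Proof.
move=> /tiles_transpose ts /tiles_transpose tt st.
have [u [tu /agree_untranspose us /agree_untranspose ut]] := fill_ul ts tt st.
exists (untranspose u); split.
- exact: tiles_untranspose.
- by case: us.
- by case: ut.
Qed.

(** Equality propagates along a row from right to left, hence from the bottom
    and right sides of each square to the whole rectangle. *)
Lemma fill_ul_uniq X m n (s t : tiling X) : tiles m n s -> tiles m n t ->
  agree m 0 s t -> agree 0 n (shift m 0 s) (shift m 0 t) -> agree m n s t.
Proof.
move=> [sa sb ss] [ra rb rs] [v0 a0 _] [_ _ bm].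
have step j : j < n -> (forall i, i < m -> ta s i j = ta t i j) ->
    forall i, i <= m -> tb s i j = tb t i j.
  move=> jn aj i im; rewrite -(subKn im).
  have : m - i <= m by lia.
  (* Downward induction on the column, starting from the right side. *)
  elim: (m - i) => [|k IH] km.
    by rewrite subn0; have := bm 0 j isT jn; rewrite /= addn0.
  have kE : (m - k.+1).+1 = m - k by lia.
  have lt : m - k.+1 < m by lia.
  have := ss _ _ lt jn; have := rs _ _ lt jn; rewrite kE aj // IH; last by lia.
  by move=> h1 h2; case: (square_ul_uniq h1 h2).
have aE j : j <= n -> forall i, i < m -> ta s i j = ta t i j.
  elim: j => [|j IH] jn i im; first exact: a0.
  have := ss _ _ im jn; have := rs _ _ im jn.
  have bj := step j jn (IH (ltnW jn)).
  rewrite (IH (ltnW jn)) // bj // => h1 h2.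
  by case: (square_ul_uniq h1 h2).
have bE i j : i <= m -> j < n -> tb s i j = tb t i j.
  by move=> im jn; apply: step => //; apply: aE; exact: ltnW.
split=> // [i [|j] im jn|i j im jn]; [exact: v0| |exact: aE].
have := sb _ _ im jn; rewrite bE // => h1.
by have [] := verE_ends h1 (rb _ _ im jn).
Qed.

Lemma fill_lr_uniq X m n (s t : tiling X) : tiles m n s -> tiles m n t ->
  agree 0 n s t -> agree m 0 (shift 0 n s) (shift 0 n t) -> agree m n s t.
Proof.
move=> /tiles_transpose ts /tiles_transpose tt /agree_transpose st0
  /agree_transpose st1.
by have /agree_untranspose[] := fill_ul_uniq ts tt st0 st1.
Qed.

(** The rectangle below [t] and to the right of [s] has its left and top sides
    prescribed, the one above [s] and to the left of [t] its bottom and right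
    sides; fill both and glue the four pieces. *)
Lemma concat_tiling X m n m' n' (s t : tiling X) :
  tiles m n s -> tiles m' n' t -> tv s m n = tv t 0 0 ->
  exists u, [/\ tiles (m + m') (n + n') u, agree m n u s &
                agree m' n' (shift m n u) t].
Proof.
move=> ts tt e.
have [||| lr [tlr lrs lrt]] := @fill_lr X m' n (shift m 0 s) t.
- by apply: tiles_shift ts; rewrite ?addn0.
- exact: tiles_le tt.
- by rewrite /= addn0.
have [||| ul [tul uls ult]] := @fill_ul X m n' (shift 0 n s) t.
- by apply: tiles_shift ts; rewrite ?addn0.
- exact: tiles_le tt.
- by rewrite /= addn0.
have [lo [tlo los lolr]] := hglue ts tlr (agree_sym lrs).
have [up [tup upul upt]] := hglue tul tt ult.
have [|u [tu ulo uup]] := vglue tlo tup.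
  apply: agree_hcat.
    apply: (@agree_trans _ _ _ _ (shift 0 n s)).
      by apply: agree_shift los; rewrite ?addn0.
    apply: agree_trans (agree_sym uls) _.
    by apply: agree_sym; apply: agree_le upul.
  apply: (@agree_trans _ _ _ _ t); last first.
    by apply: agree_sym; apply: agree_le upt.
  apply: agree_trans lrt.
  rewrite shiftD addn0 add0n.
  rewrite -{1}(addn0 m).
  by apply: (@agree_shiftD X m 0 0 n m' 0 m' n lo lr); rewrite ?addn0.
exists u; split=> //.
  by apply: agree_trans los; apply: agree_le ulo => //; exact: leq_addr.
apply: agree_trans upt.
rewrite -{1}(addn0 n).
exact: (@agree_shiftD X 0 n m 0 m' n' (m + m') n' u up).
Qed.

(** The two corner rectangles are determined by the sides that they share with
    the given ones. *)
Lemma concat_tiling_uniq X m n m' n' (s t : tiling X) :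
  tiles (m + m') (n + n') s -> tiles (m + m') (n + n') t -> agree m n s t ->
  agree m' n' (shift m n s) (shift m n t) -> agree (m + m') (n + n') s t.
Proof.
move=> ts tt st st'.
have sh p q a b u : p + a <= m + m' -> q + b <= n + n' ->
    tiles (m + m') (n + n') u -> tiles a b (@shift X p q u).
  by move=> *; apply: tiles_shift; eassumption.
apply: agree_vcat; apply: agree_hcat => //.
- apply: fill_lr_uniq; try by apply: sh => //; lia.
    by apply: agree_shift st; lia.
  by rewrite !shiftD !addn0 !add0n; apply: agree_le st'.
- apply: fill_ul_uniq; try by apply: sh => //; lia.
    by apply: agree_shift st; lia.
  by rewrite !shiftD !addn0 !add0n; apply: agree_le st'.
Qed.

End Tilings.

(** * From edges to paths *)

Definition unitdeg k (c : 'I_k) : {ffun 'I_k -> nat} := [ffun i => (i == c : nat)].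

Lemma degree_ind k (P : {ffun 'I_k -> nat} -> Prop) :
  P 0%R -> (forall c n, P n -> P (unitdeg c + n)%R) -> forall n, P n.
Proof.
move=> P0 PS n; have [s] := ubnP (\sum_i n i); elim: s n => // s IH n ns.
have [n0|] := boolP [forall i, n i == 0].
  suff -> : n = 0%R by [].
  by apply/ffunP => i; rewrite ffunE; apply/eqP/(forallP n0).
case/forallPn => c nc.
pose n' : {ffun 'I_k -> nat} := [ffun i => n i - (i == c)].
have -> : n = (unitdeg c + n')%R.
  apply/ffunP => i; rewrite !ffunE /GRing.add /=.
  by case: eqP => [->|_] /=; lia.
apply: PS; apply: IH; rewrite ltnS in ns; apply: leq_trans ns.
rewrite (bigD1 c) //= [X in _ < X](bigD1 c) //= ffunE eqxx.
have -> : \sum_(i | i != c) n' i = \sum_(i | i != c) n i.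
  by apply: eq_bigr => i /negbTE ic; rewrite ffunE ic subn0.
by rewrite ltn_add2r subn1 ltn_predL lt0n.
Qed.

Section FromEdges.
Local Open Scope classical_set_scope.
Local Open Scope ring_scope.
Variables (k : nat) (V : countType).

(** A category with the factorisation property: the k-graph axioms without the
    conditions on the number of paths, which follow from the conditions on edges
    once the rest is known. *)
Record is_factorial (L : kgraph_data k V) : Prop := IsFactorial {
  fact_rng_idm : forall v : V, rng (idm v : L) = v;
  fact_src_idm : forall v : V, src (idm v : L) = v;
  fact_rng_comp : forall x y : L, src x = rng y -> rng (comp x y) = rng x;
  fact_src_comp : forall x y : L, src x = rng y -> src (comp x y) = src y;
  fact_comp_idml : forall x : L, comp (idm (rng x)) x = x;
  fact_comp_idmr : forall x : L, comp x (idm (src x)) = x;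
  fact_comp_assoc : forall x y z : L, src x = rng y -> src y = rng z ->
    comp x (comp y z) = comp (comp x y) z;
  fact_deg_idm : forall v : V, deg (idm v : L) = 0;
  fact_deg_comp : forall x y : L, src x = rng y -> deg (comp x y) = deg x + deg y;
  fact_factorisation : forall (l : L) (m n : {ffun 'I_k -> nat}),
    deg l = m + n ->
    exists! p : L * L, [/\ src p.1 = rng p.2, l = comp p.1 p.2,
                           deg p.1 = m & deg p.2 = n]
}.

Lemma kgraph_factorial (L : kgraph_data k V) : is_kgraph L -> is_factorial L.
Proof. by case. Qed.

Variable L : kgraph_data k V.
Hypothesis LF : is_factorial L.

Lemma factor_eq (x y x' y' : L) : src x = rng y -> src x' = rng y' ->
  deg x = deg x' -> deg y = deg y' -> comp x y = comp x' y' ->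
  x = x' /\ y = y'.
Proof.
move=> xy xy' dx dy e.
have [p [_ pu]] := fact_factorisation LF (fact_deg_comp LF xy).
have ep : p = (x, y) by apply: pu.
by have : p = (x', y') by [apply: pu]; rewrite ep => -[].
Qed.

(** Both [l] and [idm (rng l)] are initial factors of [l] of degree zero. *)
Lemma deg0_idm (l : L) : deg l = 0 -> l = idm (rng l).
Proof.
move=> l0; have [] // := @factor_eq l (idm (src l)) (idm (rng l)) l.
- by rewrite (fact_rng_idm LF).
- by rewrite (fact_src_idm LF).
- by rewrite (fact_deg_idm LF).
- by rewrite (fact_deg_idm LF).
by rewrite (fact_comp_idml LF) (fact_comp_idmr LF).
Qed.

Lemma factor_ex (l : L) m n : deg l = m + n ->
  exists x y, [/\ src x = rng y, l = comp x y, deg x = m & deg y = n].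
Proof. by case/(fact_factorisation LF) => -[x y] [h _]; exists x, y. Qed.

(** A path with range [v] is an edge with range [v] followed by a shorter path
    from one of finitely many vertices. *)
Lemma kgraph_from_edges : (0 < k)%N ->
  (forall v c, [set l : L | deg l = unitdeg c /\ rng l = v] !=set0) ->
  (forall v c, finite_set [set l : L | deg l = unitdeg c /\ rng l = v]) ->
  is_kgraph L.
Proof.
move=> k_gt0 edges_neq0 edges_finite; case: (LF) => *; split=> // v n.
  elim/degree_ind: n v => [|c n IH] v.
    by exists (idm v); rewrite /= (fact_deg_idm LF) (fact_rng_idm LF).
  have [e [de re]] := edges_neq0 v c; have [l [dl rl]] := IH (src e).
  exists (comp e l).
  by rewrite /= (fact_deg_comp LF) ?(fact_rng_comp LF) ?dl ?de ?rl ?re.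
elim/degree_ind: n v => [|c n IH] v.
  apply: (@sub_finite_set _ _ [set (idm v : L)]); last exact: finite_set1.
  by move=> l [/deg0_idm {2}-> ->].
apply: (@sub_finite_set _ _
  (\bigcup_(e in [set l : L | deg l = unitdeg c /\ rng l = v])
     comp e @` [set l : L | deg l = n /\ rng l = src e])); last first.
  by apply: bigcup_finite => // e _; apply: finite_image.
move=> l [/factor_ex[e [l' [el -> de dl] rl]]].
exists e; last by exists l'.
by split=> //; rewrite -rl (fact_rng_comp LF).
Qed.

End FromEdges.

(** * Grids as tilings *)

Lemma deg2_0 : deg2 0 0 = 0%R.
Proof. by apply/ffunP => i; rewrite !ffunE; case: ifP. Qed.

Lemma deg2D m n m' n' : (deg2 m n + deg2 m' n' = deg2 (m + m') (n + n'))%R.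
Proof. by apply/ffunP => i; rewrite !ffunE; case: ifP. Qed.

Lemma deg2_inj m n m' n' : deg2 m n = deg2 m' n' -> m = m' /\ n = n'.
Proof.
by move=> e; split; [have := congr1 (fun f : {ffun 'I_2 -> nat} => f ord0) e
  | have := congr1 (fun f : {ffun 'I_2 -> nat} => f ord_max) e]; rewrite !ffunE.
Qed.

Lemma deg2E (d : {ffun 'I_2 -> nat}) : d = deg2 (d ord0) (d ord_max).
Proof.
apply/ffunP => i; rewrite ffunE; case: eqP => [->//|/eqP i0].
by congr (d _); apply/val_inj; case: i i0 => -[|[|]].
Qed.

Lemma unitdeg2 (c : 'I_2) :
  (c = ord0 /\ unitdeg c = deg2 1 0) \/ (c = ord_max /\ unitdeg c = deg2 0 1).
Proof.
have -> : unitdeg c = deg2 (unitdeg c ord0) (unitdeg c ord_max) by exact: deg2E.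
by rewrite !ffunE; case: c => -[|[|//]] p; [left|right]; split=> //; apply: val_inj.
Qed.

Section ThetaSquares.
Variables (V : countType) (A B : kgraph_data 1 V) (theta : A * B -> B * A).
Hypothesis theta_exchange : is_edge_exchange theta.

Definition is_edge (G : kgraph_data 1 V) (u : V) (a : G) (w : V) : Prop :=
  [/\ deg a = deg1 1, rng a = u & src a = w].

(** Requiring that the edges be composable makes [theta_square] injective in
    both directions, whatever the values of [theta] elsewhere. *)
Definition theta_square (a : A) (b : B) (b' : B) (a' : A) : Prop :=
  edge_pairs A B (a, b) /\ theta (a, b) = (b', a').

Definition theta_squares : squares V.
Proof.
apply: (@Squares V A B (@is_edge A) (@is_edge B) theta_square).
- by move=> u a w u' w' [_ <- <-] [_ <- <-].
- by move=> u a w u' w' [_ <- <-] [_ <- <-].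
- have [[theta_fun theta_inj theta_surj] theta_ends] := theta_exchange.
  move=> u a v b w [da ra sa] [db rb sb].
  have ab : edge_pairs A B (a, b) by split=> //=; rewrite sa.
  case E : (theta (a, b)) => [b' a'].
  have := theta_fun _ ab; have := theta_ends _ ab; rewrite E /=.
  move=> [r s] [/= db' da' e].
  by exists (src b'), b', a'; split=> //; split=> //; rewrite -?r -?s.
- have [[theta_fun theta_inj theta_surj] theta_ends] := theta_exchange.
  move=> u b' v' a' w [db rb sb] [da ra sa].
  have ba : edge_pairs B A (b', a') by split=> //=; rewrite sb.
  have [[a b] ab E] := theta_surj _ ba.
  have := theta_ends _ ab; rewrite E /= => -[r s]; case: (ab) => /= da' db' e.
  by exists (src a), a, b; split=> //; split=> //; rewrite ?r ?s.
- by move=> a b b1 a1 b2 a2 [_ e1] [_]; rewrite e1 => -[].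
- move=> a1 b1 a2 b2 b' a' [ab1 e1] [ab2 e2].
  have [[_ theta_inj _] _] := theta_exchange.
  by have [] := theta_inj (a1, b1) (a2, b2) (mem_set ab1) (mem_set ab2)
    (etrans e1 (esym e2)).
Defined.

Definition entry T p q (d : T) (M : 'M[T]_(p, q)) (i j : nat) : T :=
  if (insub i, insub j) is (Some i', Some j') then M i' j' else d.

Lemma entryE T p q (d : T) (M : 'M[T]_(p, q)) (i : 'I_p) (j : 'I_q) :
  entry d M i j = M i j.
Proof. by rewrite /entry !valK. Qed.

(** The vertex [v0] and its identity are used as default values; a grid always
    has the vertex (0, 0), while its matrices of edges may be empty. *)
Definition tiling_of m n (x : grid theta m n) : tiling theta_squares :=
  let v0 := gridv x ord0 ord0 in
  @Tiling V theta_squares (entry v0 (gridv x)) (entry (idm v0) (grida x))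
          (entry (idm v0) (gridb x)).

Lemma tiling_of_v m n (x : grid theta m n) i j :
  tv (tiling_of x) (i : 'I_m.+1) (j : 'I_n.+1) = gridv x i j.
Proof. exact: entryE. Qed.

Lemma tiling_of_a m n (x : grid theta m n) i j :
  ta (tiling_of x) (i : 'I_m) (j : 'I_n.+1) = grida x i j.
Proof. exact: entryE. Qed.

Lemma tiling_of_b m n (x : grid theta m n) i j :
  tb (tiling_of x) (i : 'I_m.+1) (j : 'I_n) = gridb x i j.
Proof. exact: entryE. Qed.

Lemma tiles_tiling_of m n (x : grid theta m n) : tiles m n (tiling_of x).
Proof.
have : is_grid theta (val x) := valP x.
have Ev := tiling_of_v x; have Ea := tiling_of_a x; have Eb := tiling_of_b x.
move: Ev Ea Eb; rewrite /gridv /grida /gridb.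
case: (val x) => [[v a] b] /= Ev Ea Eb /and3P[/forallP ha /forallP hb /forallP hs].
have ta_edge i j : i < m -> j <= n ->
    is_edge (tv (tiling_of x) i j) (ta (tiling_of x) i j) (tv (tiling_of x) i.+1 j).
  move=> im jn; have /forallP/(_ (Ordinal (jn : j < n.+1))) := ha (Ordinal im).
  by rewrite -!Ev -Ea; case/and3P => /eqP ? /eqP ? /eqP ?.
have tb_edge i j : i <= m -> j < n ->
    is_edge (tv (tiling_of x) i j) (tb (tiling_of x) i j) (tv (tiling_of x) i j.+1).
  move=> im jn; have /forallP/(_ (Ordinal jn)) := hb (Ordinal (im : i < m.+1)).
  by rewrite -!Ev -Eb; case/and3P => /eqP ? /eqP ? /eqP ?.
split=> // i j im jn.
have [da _ sa] := ta_edge i j im (ltnW jn).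
have [db rb _] := tb_edge i.+1 j im jn.
split; first by split=> //=; rewrite sa.
have /forallP/(_ (Ordinal jn))/eqP := hs (Ordinal im).
by rewrite -!Eb -!Ea.
Qed.

Lemma grid_of_tiling m n (t : tiling theta_squares) : tiles m n t ->
  exists x : grid theta m n, agree m n (tiling_of x) t.
Proof.
move=> [ha hb hs].
pose M : 'M[V]_(m.+1, n.+1) * 'M[A]_(m, n.+1) * 'M[B]_(m.+1, n) :=
  (\matrix_(i, j) tv t i j, \matrix_(i, j) (ta t i j : A),
   \matrix_(i, j) (tb t i j : B))%R.
have gM : is_grid theta M.
  apply/and3P; split; apply/forallP => i; apply/forallP => j; rewrite !mxE.
  - by have [] := ha i j (ltn_ord i) (ltn_ord j) => -> -> ->; rewrite !eqxx.
  - by have [] := hb i j (ltn_ord i) (ltn_ord j) => -> -> ->; rewrite !eqxx.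
  - by have [_ /= ->] := hs i j (ltn_ord i) (ltn_ord j).
exists (Sub M gM); split=> i j im jn.
- by rewrite (tiling_of_v _ (Ordinal (im : i < m.+1)) (Ordinal (jn : j < n.+1))) mxE.
- by rewrite (tiling_of_a _ (Ordinal im) (Ordinal (jn : j < n.+1))) mxE.
- by rewrite (tiling_of_b _ (Ordinal (im : i < m.+1)) (Ordinal jn)) mxE.
Qed.

Lemma tiling_of_inj m n (x y : grid theta m n) :
  agree m n (tiling_of x) (tiling_of y) -> x = y.
Proof.
move=> [ev ea eb]; apply: val_inj.
rewrite [LHS]surjective_pairing [RHS]surjective_pairing.
rewrite [(val x).1]surjective_pairing [(val y).1]surjective_pairing.
congr (_, _, _); apply/matrixP => i j.
- by have := ev i j (ltn_ord i) (ltn_ord j); rewrite !tiling_of_v.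
- by have := ea i j (ltn_ord i) (ltn_ord j); rewrite !tiling_of_a.
- by have := eb i j (ltn_ord i) (ltn_ord j); rewrite !tiling_of_b.
Qed.

Lemma agrees_at_entry T p q a b a' b' (Y : 'M[T]_(a', b')) (X : 'M[T]_(a, b))
    (d d' : T) : p + a <= a' -> q + b <= b' ->
  agrees_at p q Y X <-> (forall i j, i < a -> j < b ->
    entry d Y (p + i) (q + j) = entry d' X i j).
Proof.
move=> pa qb; split=> [YX i j ia jb|YX i j i' j' ei ej].
  have pi : p + i < a' by lia.
  have qj : q + j < b' by lia.
  rewrite (entryE _ _ (Ordinal ia) (Ordinal jb)).
  by rewrite (entryE _ _ (Ordinal pi) (Ordinal qj)); apply: YX.
by have := YX i j (ltn_ord i) (ltn_ord j); rewrite -ei -ej !entryE.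
Qed.

Lemma is_concatE m n m' n' (x : grid theta m n) (x' : grid theta m' n')
    (y : grid theta (m + m') (n + n')) :
  is_concat x x' y <-> agree m n (tiling_of y) (tiling_of x) /\
                       agree m' n' (shift m n (tiling_of y)) (tiling_of x').
Proof.
pose dy := gridv y ord0 ord0; pose dx := gridv x ord0 ord0.
pose dx' := gridv x' ord0 ord0.
have v := @agrees_at_entry _ 0 0 _ _ _ _ (gridv y) (gridv x) dy dx.
have a := @agrees_at_entry _ 0 0 _ _ _ _ (grida y) (grida x) (idm dy) (idm dx).
have b := @agrees_at_entry _ 0 0 _ _ _ _ (gridb y) (gridb x) (idm dy) (idm dx).
have v' := @agrees_at_entry _ m n _ _ _ _ (gridv y) (gridv x') dy dx'.
have a' := @agrees_at_entry _ m n _ _ _ _ (grida y) (grida x') (idm dy) (idm dx').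
have b' := @agrees_at_entry _ m n _ _ _ _ (gridb y) (gridb x') (idm dy) (idm dx').
split=> -[[hv ha hb] [hv' ha' hb']]; split; split.
- by apply: (v _ _).1 hv; lia.
- by apply: (a _ _).1 ha; lia.
- by apply: (b _ _).1 hb; lia.
- by apply: (v' _ _).1 hv'; lia.
- by apply: (a' _ _).1 ha'; lia.
- by apply: (b' _ _).1 hb'; lia.
- by apply: (v _ _).2 hv; lia.
- by apply: (a _ _).2 ha; lia.
- by apply: (b _ _).2 hb; lia.
- by apply: (v' _ _).2 hv'; lia.
- by apply: (a' _ _).2 ha'; lia.
- by apply: (b' _ _).2 hb'; lia.
Qed.

Lemma concat_unique m n m' n' (x : grid theta m n) (x' : grid theta m' n') :
  gridv x ord_max ord_max = gridv x' ord0 ord0 ->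
  exists! y : grid theta (m + m') (n + n'), is_concat x x' y.
Proof.
rewrite -!tiling_of_v /= => e.
have [t [tt tx tx']] := concat_tiling (tiles_tiling_of x) (tiles_tiling_of x') e.
have [y yt] := grid_of_tiling tt.
have yx : is_concat x x' y.
  apply/is_concatE; split.
    by apply: agree_trans tx; apply: agree_le yt; exact: leq_addr.
  by apply: agree_trans tx'; apply: agree_shift yt.
exists y; split=> // z xz; apply: tiling_of_inj.
have /is_concatE[yx1 yx2] := yx; have /is_concatE[zx1 zx2] := xz.
apply: concat_tiling_uniq (tiles_tiling_of y) (tiles_tiling_of z) _ _.
  exact: agree_trans yx1 (agree_sym zx1).
exact: agree_trans yx2 (agree_sym zx2).
Qed.

(** * The 2-graph of grids *)

Local Notation P := (theta_product theta).

Definition width (x : P) : nat := (tag (x : path2 theta)).1.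
Definition height (x : P) : nat := (tag (x : path2 theta)).2.
Definition path_tiling (x : P) : tiling theta_squares :=
  tiling_of (tagged (x : path2 theta)).

Lemma deg_path (x : P) : deg x = deg2 (width x) (height x).
Proof. by []. Qed.

Lemma rng_path (x : P) : rng x = tv (path_tiling x) 0 0.
Proof. by rewrite /path_tiling (tiling_of_v _ ord0 ord0). Qed.

Lemma src_path (x : P) : src x = tv (path_tiling x) (width x) (height x).
Proof. by rewrite /path_tiling (tiling_of_v _ ord_max ord_max). Qed.

Lemma tiles_path (x : P) : tiles (width x) (height x) (path_tiling x).
Proof. exact: tiles_tiling_of. Qed.

Lemma path_eq (x y : P) : width x = width y -> height x = height y ->
  agree (width x) (height x) (path_tiling x) (path_tiling y) -> x = y.
Proof.
rewrite /width /height /path_tiling.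
case: x => -[m n] x; case: y => -[m' n'] y /= em en; subst m' n'.
by move=> /tiling_of_inj ->.
Qed.

Lemma path_of_tiling m n (t : tiling theta_squares) : tiles m n t ->
  exists x : P, [/\ width x = m, height x = n & agree m n (path_tiling x) t].
Proof. by move=> /grid_of_tiling[x xt]; exists (mk_path2 x). Qed.

(** The graph of composition, free of casts between the types of grids of equal
    sizes; by [path_concatE] it is enough to exhibit the pieces in order to
    compute a composite. *)
Definition path_concat (x y z : P) : Prop :=
  [/\ width z = width x + width y, height z = height x + height y,
      agree (width x) (height x) (path_tiling z) (path_tiling x) &
      agree (width y) (height y) (shift (width x) (height x) (path_tiling z))
            (path_tiling y)].

Lemma path_concat_ends x y z : path_concat x y z -> src x = rng y.
Proof.
move=> [_ _ [e _ _] [e' _ _]]; rewrite src_path rng_path -e // -e' //=.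
by rewrite !addn0.
Qed.

Lemma path_concat_comp (x y : P) : src x = rng y -> path_concat x y (comp x y).
Proof.
move=> e; have [z [xyz _]] := concat_unique e.
have : (exists w : path2 theta,
  [set mk_path2 z | z in is_concat (tagged x) (tagged y)]%classic w).
  by exists (mk_path2 z), z.
rewrite /comp /= /path2_comp => /(xgetPex x)[w /is_concatE[wx wy] <-].
by split.
Qed.

Lemma path_concatE (x y z : P) : path_concat x y z -> z = comp x y.
Proof.
move=> xyz; have [w h cx cy] := path_concat_comp (path_concat_ends xyz).
have [w' h' zx zy] := xyz.
have tz := tiles_path z; have tc := tiles_path (comp x y).
apply: path_eq; rewrite ?w ?w' ?h ?h' //.
rewrite w' h' in tz; rewrite w h in tc.
by apply: concat_tiling_uniq => //;
  [exact: agree_trans (agree_sym cx)|exact: agree_trans (agree_sym cy)].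
Qed.

Lemma subpath (z : P) p q m n : p + m <= width z -> q + n <= height z ->
  exists x : P, [/\ width x = m, height x = n &
                    agree m n (path_tiling x) (shift p q (path_tiling z))].
Proof. by move=> pm qn; apply: path_of_tiling; apply: tiles_shift (tiles_path z). Qed.

Lemma path_vertex (v : V) : [/\ width (idm v : P) = 0, height (idm v : P) = 0 &
  tv (path_tiling (idm v)) 0 0 = v].
Proof. by split=> //; rewrite (tiling_of_v (grid_vertex theta v) ord0 ord0) mxE. Qed.

(** Every equation between composites is checked by comparing pieces. *)
Lemma theta_product_factorial : is_factorial P.
Proof.
have rc (x y : P) : src x = rng y -> rng (comp x y) = rng x.
  by move=> /path_concat_comp[_ _ [e _ _] _]; rewrite !rng_path e.
have sc (x y : P) : src x = rng y -> src (comp x y) = src y.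
  move=> /path_concat_comp[w h _ [e _ _]].
  by rewrite !src_path -e //= w h.
split=> //.
- by move=> v; rewrite /= mxE.
- by move=> v; rewrite /= mxE.
- move=> x; apply/esym/path_concatE; have [w h e] := path_vertex (rng x).
  split; rewrite ?w ?h ?shift00 //; split=> // -[] // [] // _ _.
  by rewrite e rng_path.
- move=> x; apply/esym/path_concatE; have [w h e] := path_vertex (src x).
  split; rewrite ?w ?h ?addn0 //; split=> // -[] // [] // _ _.
  by rewrite e src_path /= !addn0.
- move=> x y z xy yz; set l := comp (comp x y) z.
  have [|w1 h1 a1 b1] := @path_concat_comp (comp x y) z; first by rewrite sc.
  have [w2 h2 a2 b2] := path_concat_comp xy.
  have [||u [wu hu ut]] := @subpath l (width x) (height x)
      (width y + width z) (height y + height z).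
  - by rewrite w1 w2 addnA.
  - by rewrite h1 h2 addnA.
  (* The rest [u] of the grid [l] after [x] consists of [y] and [z]. *)
  have -> : comp y z = u.
    apply/esym/path_concatE; split=> //.
      apply: (@agree_trans _ _ _ _ _ (shift (width x) (height x) (path_tiling l))).
        by apply: agree_le ut; lia.
      by apply: agree_trans b2; apply: agree_shift a1; lia.
    apply: agree_trans b1; rewrite w2 h2 -shiftD.
    by apply: agree_shift ut; lia.
  apply/esym/path_concatE; split; rewrite ?wu ?hu ?w1 ?w2 ?h1 ?h2 ?addnA //.
    by apply: agree_trans a2; apply: agree_le a1; lia.
  exact: agree_sym.
- by move=> v; exact: deg2_0.
- move=> x y /path_concat_comp[w h _ _].
  by rewrite !deg_path deg2D w h.
move=> l m n; rewrite deg_path (deg2E m) (deg2E n) deg2D => /deg2_inj[lw lh].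
have [||x [xw xh xl]] := @subpath l 0 0 (m ord0) (m ord_max); try lia.
have [||y [yw yh yl]] := @subpath l (m ord0) (m ord_max) (n ord0) (n ord_max); try lia.
rewrite shift00 in xl.
exists (x, y); split.
  rewrite !deg_path xw xh yw yh.
  have c : path_concat x y l.
    by split; rewrite ?xw ?xh ?yw ?yh //; exact: agree_sym.
  by split=> //; [exact: path_concat_ends c|exact: path_concatE].
move=> [x' y'] [xy el]; rewrite !deg_path => /deg2_inj[xw' xh'] /deg2_inj[yw' yh'].
have := path_concat_comp xy; rewrite -el => -[_ _].
rewrite xw' xh' yw' yh' => lx ly.
congr (_, _); apply: path_eq; rewrite ?xw ?xh ?yw ?yh //.
  exact: agree_trans lx.
exact: agree_trans ly.
Qed.

(** Together with [hor_path_inj], this identifies the paths of degree (1, 0) with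
    the edges of [A]; those of degree (0, 1) are likewise the edges of [B]. *)
Lemma hor_path u a w : is_edge u a w -> exists x : P,
  [/\ width x = 1, height x = 0 &
   [/\ ta (path_tiling x) 0 0 = a, rng x = u & src x = w]].
Proof.
move=> ha.
have [|x [xw xh [ev ea _]]] := @path_of_tiling 1 0 (@Tiling V theta_squares
  (fun i _ => if i is 0 then u else w) (fun _ _ => a) (fun _ _ => idm u)).
  by split=> // -[].
by exists x; rewrite rng_path src_path xw xh ev ?ev ?ea.
Qed.

Lemma ver_path u b w : is_edge u b w -> exists x : P,
  [/\ width x = 0, height x = 1 &
   [/\ tb (path_tiling x) 0 0 = b, rng x = u & src x = w]].
Proof.
move=> ha.
have [|x [xw xh [ev _ eb]]] := @path_of_tiling 0 1 (@Tiling V theta_squares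
  (fun _ i => if i is 0 then u else w) (fun _ _ => idm u) (fun _ _ => b)).
  by split=> // i [].
by exists x; rewrite rng_path src_path xw xh ev ?ev ?eb.
Qed.

Lemma hor_path_inj (x y : P) : width x = 1 -> height x = 0 -> deg x = deg y ->
  ta (path_tiling x) 0 0 = ta (path_tiling y) 0 0 -> x = y.
Proof.
rewrite !deg_path => xw xh /deg2_inj[w h] e.
have [ax _ _] := tiles_path x; have [ay _ _] := tiles_path y.
apply: path_eq => //; rewrite xw xh in w h ax ay *; rewrite -w -h in ay.
have hx := ax 0 0 isT isT; have hy := ay 0 0 isT isT.
rewrite e in hx; have [e0 e1] := horE_ends hx hy.
by split=> -[|[|i]] [|j].
Qed.

Lemma ver_path_inj (x y : P) : width x = 0 -> height x = 1 -> deg x = deg y ->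
  tb (path_tiling x) 0 0 = tb (path_tiling y) 0 0 -> x = y.
Proof.
rewrite !deg_path => xw xh /deg2_inj[w h] e.
have [_ ax _] := tiles_path x; have [_ ay _] := tiles_path y.
apply: path_eq => //; rewrite xw xh in w h ax ay *; rewrite -w -h in ay.
have hx := ax 0 0 isT isT; have hy := ay 0 0 isT isT.
rewrite e in hx; have [e0 e1] := verE_ends hx hy.
by split=> -[|i] [|[|j]].
Qed.

Local Open Scope classical_set_scope.

Lemma theta_product_kgraph : is_kgraph A -> is_kgraph B -> is_kgraph P.
Proof.
move=> Agraph Bgraph; apply: kgraph_from_edges => //.
- exact: theta_product_factorial.
- move=> v c; case: (unitdeg2 c) => -[_ ->].
    have [a [da ra]] := paths_neq0 Agraph v (deg1 1).
    have [|x [xw xh [_ xr _]]] := @hor_path v a (src a); first by [].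
    by exists x; split; rewrite // deg_path xw xh.
  have [b [db rb]] := paths_neq0 Bgraph v (deg1 1).
  have [|x [xw xh [_ xr _]]] := @ver_path v b (src b); first by [].
  by exists x; split; rewrite // deg_path xw xh.
move=> v c; case: (unitdeg2 c) => -[_ ->].
  have fin := paths_finite Agraph v (deg1 1).
  (* Finitely many grids, because each one is recovered from its only edge. *)
  pose g a := xget (idm v : P)
    [set x : P | deg x = deg2 1 0 /\ ta (path_tiling x) 0 0 = a].
  apply: sub_finite_set (finite_image g fin) => x [dx rx].
  have := dx; rewrite deg_path => /deg2_inj[xw xh].
  have [hx _ _] := tiles_path x; rewrite xw xh in hx.
  have [da ra _] := hx 0 0 isT isT.
  exists (ta (path_tiling x) 0 0); first by rewrite /= da ra -rng_path.
  apply: xget_unique => // y [dy ey].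
  by apply/esym; apply: hor_path_inj; rewrite // dx dy.
have fin := paths_finite Bgraph v (deg1 1).
pose g a := xget (idm v : P)
  [set x : P | deg x = deg2 0 1 /\ tb (path_tiling x) 0 0 = a].
apply: sub_finite_set (finite_image g fin) => x [dx rx].
have := dx; rewrite deg_path => /deg2_inj[xw xh].
have [_ hx _] := tiles_path x; rewrite xw xh in hx.
have [da ra _] := hx 0 0 isT isT.
exists (tb (path_tiling x) 0 0); first by rewrite /= da ra -rng_path.
apply: xget_unique => // y [dy ey].
by apply/esym; apply: ver_path_inj; rewrite // dx dy.
Qed.

End ThetaSquares.

(** * Functors that are bijective on edges *)

Section Isomorphism.
Variables (k : nat) (V : countType) (L L' : kgraph_data k V) (f : L -> L').
Hypotheses (LF : is_factorial L) (LF' : is_factorial L').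
Hypothesis f_morph : is_morphism id f.

(** By induction on the degree, cutting off one edge at a time: unique
    factorisation in the target gives injectivity, and surjectivity holds
    because the functor is the identity on objects, so that preimages of
    composable paths are composable. *)
Lemma isomorphic_from_edges :
  (forall c x y, deg x = unitdeg c -> deg y = unitdeg c -> f x = f y -> x = y) ->
  (forall c y, deg y = unitdeg c -> exists x, f x = y) ->
  isomorphic L L'.
Proof.
case: (f_morph) => frng fsrc fidm fcomp fdeg edge_inj edge_surj.
have f_inj : injective f.
  move=> x; move: {2}(deg x) (erefl (deg x)) => n.
  elim/degree_ind: n x => [|c n IH] x dx y exy.
    have dy : deg y = 0%R by rewrite -fdeg -exy fdeg.
    rewrite (deg0_idm LF dx) (deg0_idm LF dy); congr idm.
    by rewrite -[rng x]/(id _) -[rng y]/(id _) -!frng exy.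
  have dy : deg y = (unitdeg c + n)%R by rewrite -fdeg -exy fdeg.
  have [e [z [ez xE de dz]]] := factor_ex LF dx.
  have [e' [z' [ez' yE de' dz']]] := factor_ex LF dy.
  move: exy; rewrite xE yE !fcomp // => exy.
  have [||||/(edge_inj c) -> // /IH->] // := factor_eq LF' _ _ _ _ exy.
  - by rewrite fsrc frng /= ez.
  - by rewrite fsrc frng /= ez'.
  - by rewrite !fdeg de.
  - by rewrite !fdeg dz.
have f_surj y : exists x, f x = y.
  move: {2}(deg y) (erefl (deg y)) => n.
  elim/degree_ind: n y => [|c n IH] y dy.
    by exists (idm (rng y)); rewrite fidm -(deg0_idm LF').
  have [e [z [ez -> /edge_surj[e0 e0E] /IH[z0 z0E]]]] := factor_ex LF' dy.
  exists (comp e0 z0); rewrite fcomp ?e0E ?z0E //.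
  by rewrite -[src e0]/(id _) -[rng z0]/(id _) -fsrc -frng e0E z0E.
have [g fK] : exists g, cancel g f.
  by exists (fun y => sval (cid (f_surj y))) => y; case: cid.
have gK : cancel f g by move=> x; apply: f_inj.
have grng y : rng (g y) = rng y by rewrite -{2}(fK y) frng.
have gsrc y : src (g y) = src y by rewrite -{2}(fK y) fsrc.
exists id, f, id, g; split=> //; split=> //.
- by move=> v; apply: f_inj; rewrite fK fidm.
- by move=> x y xy; apply: f_inj; rewrite fcomp ?fK // gsrc grng.
- by move=> x; rewrite -{2}(fK x) fdeg.
Qed.

End Isomorphism.

(** * Vertex matrices *)

Lemma cardfsM (T U : choiceType) (X : {fset T}) (Y : {fset U}) :
  #|` (X `*` Y)%fset| = (#|` X| * #|` Y|)%N.
Proof.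
rewrite -(size_allpairs pair); apply: perm_size; apply: uniq_perm => //.
  by apply: allpairs_uniq => // -[x y] [x' y'].
move=> [x y]; rewrite in_fsetM /=; apply/andP/allpairsP.
  by move=> [xX yY]; exists (x, y).
by move=> [[x' y'] [? ? [-> ->]]].
Qed.

Section VertexMatrices.
Local Open Scope classical_set_scope.
Local Open Scope ring_scope.
Variables (V : countType) (A B : kgraph_data 1 V).
Hypotheses (AG : is_kgraph A) (BG : is_kgraph B).

Definition pairs_between (u w : V) : set (A * B) :=
  [set p | edge_pairs A B p /\ rng p.1 = u /\ src p.2 = w].

Lemma pairs_between_finite u w : finite_set (pairs_between u w).
Proof.
have AF := paths_finite AG u (deg1 1).
apply: (@sub_finite_set _ _
  (\bigcup_(a in [set a : A | deg a = deg1 1 /\ rng a = u])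
     pair a @` [set b : B | deg b = deg1 1 /\ rng b = src a])); last first.
  by apply: bigcup_finite => // a _; apply/finite_image/paths_finite.
move=> [a b] [[/= da db ab] [ra sb]]; exists a => //.
by exists b.
Qed.

(** The product of the vertex matrices counts pairs of edges, sorted by their
    middle vertex; the middle vertices that occur form a finite set. *)
Lemma vertex_matrix_prod u w :
  \sum_(v \in [set: V]) (vertex_matrix A u v * vertex_matrix B v w)%N =
  #|` fset_set (pairs_between u w)|%N.
Proof.
set Q := fset_set _.
have edges_finite (G : kgraph_data 1 V) x y : is_kgraph G ->
    finite_set [set l : G | [/\ deg l = deg1 1, rng l = x & src l = y]].
  move=> GG; apply: sub_finite_set (paths_finite GG x (deg1 1)).
  by move=> l [].
have fiber v : (vertex_matrix A u v * vertex_matrix B v w)%N =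
    \sum_(p <- Q | src p.1 == v) 1%N.
  rewrite /vertex_matrix -cardfsM -fset_setX; try exact: edges_finite.
  have <- : \sum_(p <- [fset p in Q | src p.1 == v]%fset) 1%N =
      \sum_(p <- Q | src p.1 == v) 1%N by rewrite big_fset.
  rewrite -card_fset_sum1; congr #|` _|%N.
  apply/fsetP => -[a b].
  rewrite in_fset_set; last by apply: finite_setX; apply: edges_finite.
  rewrite !inE /= in_fset_set; last exact: pairs_between_finite.
  apply/idP/andP => [/set_mem[[/= da ra sa] [db rb sb]]|].
    split; last exact/eqP.
    by apply/mem_set; split=> //; split=> //=; rewrite sa.
  by move=> [/set_mem[[/= da db ab] [ra sb]] /eqP sa]; apply/mem_set; rewrite -sa.
rewrite (fsbigTE [fset src p.1 | p in Q]%fset).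
  rewrite card_fset_sum1 (partition_big_imfset _ (fun p : A * B => src p.1)) /=.
  by apply: eq_bigr => v _.
move=> v vQ; rewrite fiber big_seq_cond big1 // => p /andP[pQ /eqP pv].
by case/negP: vQ; apply/imfsetP; exists p.
Qed.

End VertexMatrices.

(** The exchange restricts to a bijection between the pairs of edges from [u] to
    [w] of the two kinds. *)
Lemma edge_exchange_commute (V : countType) (A B : kgraph_data 1 V)
    (theta : A * B -> B * A) : is_kgraph A -> is_kgraph B ->
  is_edge_exchange theta -> vertex_matrices_commute A B.
Proof.
move=> AG BG [[theta_fun theta_inj theta_surj] theta_ends] u w.
rewrite !vertex_matrix_prod //.
have -> : @pairs_between V B A u w = (theta @` @pairs_between V A B u w)%classic.
  apply/seteqP; split=> [q [qe [ru sw]]|_ [p [pe [ru sw]] <-]].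
    have [p pe pq] := theta_surj q qe; have [r s] := theta_ends p pe.
    by exists p => //; split=> //; rewrite r s pq.
  have [r s] := theta_ends p pe.
  by split; [exact: theta_fun|rewrite -r -s].
rewrite fset_set_image ?card_in_imfset //; last exact: pairs_between_finite.
move=> p q; rewrite !in_fset_set; try exact: pairs_between_finite.
by move=> /set_mem[pe _] /set_mem[qe _]; apply: theta_inj; exact: mem_set.
Qed.

(** * Segments of a path *)

Section Segments.
Local Open Scope ring_scope.
Variables (k : nat) (V : countType) (L : kgraph_data k V).
Hypothesis LF : is_factorial L.

(** The factor [y] of [l] that starts in degree [p], often written
    l(p, p + deg y); it is unique by [segment_uniq]. *)
Definition segment (l : L) (p : {ffun 'I_k -> nat}) (y : L) : Prop :=
  exists w z, [/\ src w = rng y, src y = rng z, l = comp w (comp y z) & deg w = p].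

Lemma degD_inj (m n n' : {ffun 'I_k -> nat}) : m + n = m + n' -> n = n'.
Proof.
move=> /ffunP e; apply/ffunP => i; have := e i.
by rewrite !ffunE /GRing.add /=; lia.
Qed.

Lemma segment_refl l : segment l 0 l.
Proof.
exists (idm (rng l)), (idm (src l)).
rewrite (fact_src_idm LF) (fact_rng_idm LF) (fact_comp_idmr LF).
by rewrite (fact_comp_idml LF) (fact_deg_idm LF).
Qed.

Lemma segment_uniq l p y y' :
  segment l p y -> segment l p y' -> deg y = deg y' -> y = y'.
Proof.
move=> [w [z [wy yz -> <-]]] [w' [z' [wy' yz' e dw]]] dy.
have r : rng (comp y z) = rng y by rewrite (fact_rng_comp LF).
have r' : rng (comp y' z') = rng y' by rewrite (fact_rng_comp LF).
have dyz : deg (comp y z) = deg (comp y' z').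
  have := congr1 deg e; rewrite (fact_deg_comp LF) ?r //.
  rewrite [in RHS](fact_deg_comp LF) ?r' //.
  by rewrite dw; exact: degD_inj.
have [||_ e'] := factor_eq LF _ _ (esym dw) dyz e; [by rewrite r|by rewrite r'|].
have dz : deg z = deg z'.
  by move: dyz; rewrite !(fact_deg_comp LF) // dy; exact: degD_inj.
by have [] := factor_eq LF yz yz' dy dz e'.
Qed.

Lemma segment_ex l p n r : deg l = p + n + r ->
  exists y, deg y = n /\ segment l p y.
Proof.
rewrite -addrA => /(factor_ex LF)[w [u [wu -> dw]]].
move=> /(factor_ex LF)[y [z [yz uE dy dz]]].
exists y; split=> //; exists w, z; rewrite -uE; split=> //.
by rewrite wu uE (fact_rng_comp LF).
Qed.

Lemma segment_compl x y p s : src x = rng y ->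
  segment x p s -> segment (comp x y) p s.
Proof.
move=> xy [w [z [ws sz xE dw]]]; exists w, (comp z y).
have r : rng (comp s z) = rng s by rewrite (fact_rng_comp LF).
have zy : src z = rng y.
  by rewrite -xy xE (fact_src_comp LF) ?r // (fact_src_comp LF).
split=> //; first by rewrite (fact_rng_comp LF).
rewrite xE -(fact_comp_assoc LF) ?r // ?(fact_src_comp LF) //.
by rewrite (fact_comp_assoc LF sz).
Qed.

Lemma segment_compr x y p s : src x = rng y ->
  segment y p s -> segment (comp x y) (deg x + p) s.
Proof.
move=> xy [w [z [ws sz yE dw]]]; exists (comp x w), z.
have r : rng (comp s z) = rng s by rewrite (fact_rng_comp LF).
have xw : src x = rng w by rewrite xy yE (fact_rng_comp LF) // r.
split=> //; first by rewrite (fact_src_comp LF).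
  by rewrite yE (fact_comp_assoc LF) // r.
by rewrite (fact_deg_comp LF) // dw.
Qed.

(** The factorisations of [l] around [y] and around [y'] cut [l] at the same
    degree [p + deg y], hence at the same place. *)
Lemma segment_cat l p y y' : segment l p y -> segment l (p + deg y) y' ->
  src y = rng y' /\ segment l p (comp y y').
Proof.
move=> [w [z [wy yz -> dw]]] [w' [z' [wy' yz' e dw']]].
have r : rng (comp y' z') = rng y' by rewrite (fact_rng_comp LF).
rewrite (fact_comp_assoc LF) // in e.
have s : src (comp w y) = src y by rewrite (fact_src_comp LF).
have dwy : deg (comp w y) = deg w' by rewrite (fact_deg_comp LF) // dw dw'.
have dz : deg z = deg (comp y' z').
  have := congr1 deg e; rewrite (fact_deg_comp LF) ?s //.
  rewrite [in RHS](fact_deg_comp LF) ?r // dwy; exact: degD_inj.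
have [||wE zE] := factor_eq LF _ _ dwy dz e; [by rewrite s|by rewrite r|].
have yy' : src y = rng y' by rewrite -s wE.
split=> //; exists w, z'; split=> //.
- by rewrite (fact_rng_comp LF).
- by rewrite (fact_src_comp LF).
by rewrite zE (fact_comp_assoc LF yy').
Qed.

Lemma segment_rng l v : segment l 0 (idm v) -> rng l = v.
Proof.
move=> sv; have [|<- _] := segment_cat sv (y' := l).
  by rewrite (fact_deg_idm LF) addr0; exact: segment_refl.
by rewrite (fact_src_idm LF).
Qed.

Lemma segment_src l v : segment l (deg l) (idm v) -> src l = v.
Proof.
move=> sv; have [|-> _] := segment_cat (segment_refl l) (y' := idm v).
  by rewrite add0r.
by rewrite (fact_rng_idm LF).
Qed.

End Segments.

(** * Coordinate graphs *)

Section CoordinateGraphs.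
Local Open Scope classical_set_scope.
Local Open Scope ring_scope.
Variables (V : countType) (L : kgraph 2 V).
Let LF : is_factorial L := kgraph_factorial (kgraphP L).

Definition axisdeg (c : 'I_2) (n : nat) : {ffun 'I_2 -> nat} :=
  [ffun i => if i == c then n else 0%N].

Lemma on_axisP c (l : L) : reflect (deg l = axisdeg c (deg l c)) (on_axis c l).
Proof.
apply: (iffP forallP) => [h|-> i]; last by rewrite ffunE; case: eqP.
apply/ffunP => i; rewrite ffunE; have := h i; case: eqP => [->|_] //=.
by move/eqP.
Qed.

Lemma axisdegD c m n : axisdeg c m + axisdeg c n = axisdeg c (m + n).
Proof. by apply/ffunP => i; rewrite !ffunE; case: ifP. Qed.

Lemma on_axis_deg c (l : L) n : deg l = axisdeg c n -> on_axis c l.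
Proof. by move=> dl; apply/on_axisP; rewrite dl; congr axisdeg; rewrite ffunE eqxx. Qed.

Lemma deg1E (d : {ffun 'I_1 -> nat}) : d = deg1 (d ord0).
Proof. by apply/ffunP => i; rewrite ffunE (ord1 i). Qed.

Lemma deg1D m n : deg1 m + deg1 n = deg1 (m + n).
Proof. by apply/ffunP => i; rewrite !ffunE. Qed.

Lemma deg1_inj : injective deg1.
Proof.
by move=> m n /(congr1 (fun f : {ffun 'I_1 -> nat} => f ord0)); rewrite !ffunE.
Qed.

Variable c : 'I_2.
Local Notation C := (coordinate_graph L c).

Lemma coord_degE (x : C) n : deg x = deg1 n <-> deg (val x) = axisdeg c n.
Proof.
split; first by move/deg1_inj => <-; apply/on_axisP/(valP x).
by move=> dx; rewrite [LHS]/(deg1 (deg (val x) c)) dx ffunE eqxx.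
Qed.

Lemma coord_comp (x y : C) : src x = rng y -> val (comp x y) = comp (val x) (val y).
Proof.
move=> xy; rewrite insubdK //; apply/on_axisP.
have /on_axisP dx := valP x; have /on_axisP dy := valP y.
by rewrite (fact_deg_comp LF) // dx dy axisdegD ffunE eqxx.
Qed.

Lemma coordP (l : L) n : deg l = axisdeg c n ->
  exists x : C, val x = l /\ deg x = deg1 n.
Proof. by move=> dl; exists (Sub l (on_axis_deg dl)); split=> //; apply/coord_degE. Qed.

Lemma coordinate_graphP : is_kgraph C.
Proof.
have rv (x : C) : rng x = rng (val x) by [].
have sv (x : C) : src x = src (val x) by [].
have rc (x y : C) : src x = rng y -> rng (comp x y) = rng x.
  by move=> xy; rewrite rv coord_comp // (fact_rng_comp LF).
have sc (x y : C) : src x = rng y -> src (comp x y) = src y.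
  by move=> xy; rewrite sv coord_comp // (fact_src_comp LF).
have ri (v : V) : rng (idm v : C) = v by exact: (fact_rng_idm LF).
have si (v : V) : src (idm v : C) = v by exact: (fact_src_idm LF).
split=> //.
- by move=> x; apply: val_inj; rewrite coord_comp ?si //; exact: (fact_comp_idml LF).
- by move=> x; apply: val_inj; rewrite coord_comp ?ri //; exact: (fact_comp_idmr LF).
- move=> x y z xy yz; apply: val_inj; rewrite !coord_comp ?rc ?sc //.
  exact: (fact_comp_assoc LF).
- move=> v; apply/coord_degE; rewrite (fact_deg_idm LF).
  by apply/ffunP => i; rewrite !ffunE; case: ifP.
- move=> x y xy; rewrite (deg1E (deg x)) (deg1E (deg y)) deg1D.
  apply/coord_degE; rewrite coord_comp // (fact_deg_comp LF) // -axisdegD.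
  by congr (_ + _); apply/coord_degE/deg1E.
- move=> l m n; rewrite (deg1E m) (deg1E n) deg1D => /coord_degE.
  rewrite -axisdegD => /(factor_ex LF)[x0 [y0 [xy lE dx dy]]].
  have [x [xE dx']] := coordP dx; have [y [yE dy']] := coordP dy.
  subst x0 y0; exists (x, y); split.
    by split=> //; apply: val_inj; rewrite coord_comp.
  move=> [x' y'] [/= xy' lE' /coord_degE dx'' /coord_degE dy''].
  have := lE; rewrite lE' coord_comp // => /esym/(factor_eq LF xy xy')[].
  - by rewrite dx.
  - by rewrite dy.
  by move=> /val_inj -> /val_inj ->.
- move=> v n; have [l [dl rl]] := paths_neq0 (kgraphP L) v (axisdeg c (n ord0)).
  have [x [xE dx]] := coordP dl; exists x; split; first by rewrite dx -deg1E.
  by rewrite -rl -xE.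
move=> v n; have fin := paths_finite (kgraphP L) v (axisdeg c (n ord0)).
apply: sub_finite_set (finite_image (insubd (idm v : C)) fin) => x [dx rx].
exists (val x); last by rewrite valKd.
by split=> //; apply/coord_degE; rewrite dx -deg1E.
Qed.

End CoordinateGraphs.

Section Exchange.
Local Open Scope classical_set_scope.
Local Open Scope ring_scope.
Variables (V : countType) (L : kgraph 2 V).
Let LF : is_factorial L := kgraph_factorial (kgraphP L).

(** The degree of the composite is a sum of two axis degrees, which commute;
    factorise in the other order. *)
Lemma edge_pairs_swap c c' (p : coordinate_graph L c * coordinate_graph L c') :
  edge_pairs _ _ p ->
  exists q : coordinate_graph L c' * coordinate_graph L c,
    edge_pairs _ _ q /\ comp (val q.1) (val q.2) = comp (val p.1) (val p.2).
Proof.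
case: p => x y [/= /coord_degE dx /coord_degE dy xy].
have := fact_deg_comp LF xy; rewrite [deg (val x)]dx [deg (val y)]dy addrC.
move=> /(factor_ex LF)[y0 [x0 [yx E dy0 dx0]]].
have [y' [yE dy']] := coordP dy0; have [x' [xE dx']] := coordP dx0.
by exists (y', x'); rewrite /= yE xE; split=> //; split=> //=;
  rewrite -?yE -?xE in yx *.
Qed.

Lemma edge_pairs_inj c c' (p q : coordinate_graph L c * coordinate_graph L c') :
  edge_pairs _ _ p -> edge_pairs _ _ q ->
  comp (val p.1) (val p.2) = comp (val q.1) (val q.2) -> p = q.
Proof.
case: p => x y; case: q => x' y'.
move=> [/= /coord_degE dx /coord_degE dy xy] [/= /coord_degE dx' /coord_degE dy' xy'].
move=> /(factor_eq LF xy xy')[|| /val_inj -> /val_inj -> //].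
- by rewrite dx dx'.
- by rewrite dy dy'.
Qed.

Local Notation A := (coordinate_graph L ord0).
Local Notation B := (coordinate_graph L ord_max).

(** The exchange of a 2-graph; the default value in [xget] is only reached on
    pairs that are not composable edges. *)
Definition swap (p : A * B) : B * A :=
  xget (idm (rng p.1), idm (rng p.1))
    [set q | edge_pairs B A q /\ comp (val q.1) (val q.2) = comp (val p.1) (val p.2)].

Lemma swapP p : edge_pairs A B p -> edge_pairs B A (swap p) /\
  comp (val (swap p).1) (val (swap p).2) = comp (val p.1) (val p.2).
Proof. by move=> /edge_pairs_swap; exact: xgetPex. Qed.

Lemma swap_eq p q : edge_pairs A B p -> edge_pairs B A q ->
  comp (val q.1) (val q.2) = comp (val p.1) (val p.2) -> swap p = q.
Proof.
move=> /swapP[sp e] qe e'; apply: edge_pairs_inj => //.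
by rewrite e e'.
Qed.

Lemma swap_exchange : is_edge_exchange swap.
Proof.
split.
  split.
  - by move=> p /swapP[].
  - move=> p q /set_mem pe /set_mem qe e; apply: edge_pairs_inj => //.
    by rewrite -(swapP pe).2 -(swapP qe).2 e.
  - move=> q qe; have [p [pe e]] := edge_pairs_swap qe.
    by exists p => //; apply: swap_eq.
move=> p pe; have [[_ _ qe] e] := swapP pe; have [_ _ pe'] := pe.
split.
  have := congr1 rng e.
  by rewrite (fact_rng_comp LF) // (fact_rng_comp LF).
have := congr1 src e.
by rewrite (fact_src_comp LF) // (fact_src_comp LF).
Qed.

(** * The grid traced by a path *)

Local Notation P := (theta_product swap).
Local Notation pt := (path_tiling swap_exchange).

(** The vertices and edges of [x] are the segments of [l] at the same
    position; a vertex is recorded by its identity, a segment of degree zero. *)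
Record traces (l : L) (x : P) : Prop := Traces {
  trace_deg : deg l = deg x;
  trace_v : forall i j, (i <= width x)%N -> (j <= height x)%N ->
    segment l (deg2 i j) (idm (tv (pt x) i j));
  trace_a : forall i j, (i < width x)%N -> (j <= height x)%N ->
    segment l (deg2 i j) (val (ta (pt x) i j : A));
  trace_b : forall i j, (i <= width x)%N -> (j < height x)%N ->
    segment l (deg2 i j) (val (tb (pt x) i j : B))
}.

Lemma axisdeg0 n : axisdeg ord0 n = deg2 n 0.
Proof. by apply/ffunP => i; rewrite !ffunE. Qed.

Lemma axisdeg1 n : axisdeg ord_max n = deg2 0 n.
Proof. by rewrite [LHS]deg2E !ffunE. Qed.

(** Consecutive segments of [l] are composable, so their ends match; both sides
    of a unit square compose to the segment of degree (1, 1) at its corner, hence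
    the square commutes. *)
Lemma trace_ex l : exists x : P, traces l x.
Proof.
pose m := deg l ord0; pose n := deg l ord_max.
have dl : deg l = deg2 m n := deg2E (deg l).
pose seg i j d := xget l [set s | deg s = d /\ segment l (deg2 i j) s].
have segP i j p q : (i + p <= m)%N -> (j + q <= n)%N ->
    deg (seg i j (deg2 p q)) = deg2 p q /\ segment l (deg2 i j) (seg i j (deg2 p q)).
  move=> im jn; apply: (@xgetPex _ l [set s | deg s = _ /\ segment l _ s]).
  apply: (segment_ex LF (r := deg2 (m - (i + p)) (n - (j + q)))).
  by rewrite dl !deg2D; congr deg2; lia.
pose v i j := rng (seg i j (deg2 0 0)).
pose a i j : A := insubd (idm (rng l) : A) (seg i j (deg2 1 0)).
pose b i j : B := insubd (idm (rng l) : B) (seg i j (deg2 0 1)).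
have vP i j : (i <= m)%N -> (j <= n)%N -> segment l (deg2 i j) (idm (v i j)).
  move=> im jn; have [||d s] := segP i j 0%N 0%N; rewrite ?addn0 //.
  by rewrite /v -(deg0_idm LF) // d deg2_0.
have aP i j : (i < m)%N -> (j <= n)%N ->
    deg (a i j) = deg1 1 /\ segment l (deg2 i j) (val (a i j)).
  move=> im jn; have [||d s] := segP i j 1%N 0%N; rewrite ?addn0 ?addn1 //.
  have da : val (a i j) = seg i j (deg2 1 0).
    by rewrite insubdK //; apply: (@on_axis_deg _ _ _ _ 1); rewrite d axisdeg0.
  by split; [apply/coord_degE; rewrite da d axisdeg0|rewrite da].
have bP i j : (i <= m)%N -> (j < n)%N ->
    deg (b i j) = deg1 1 /\ segment l (deg2 i j) (val (b i j)).
  move=> im jn; have [||d s] := segP i j 0%N 1%N; rewrite ?addn0 ?addn1 //.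
  have db : val (b i j) = seg i j (deg2 0 1).
    by rewrite insubdK //; apply: (@on_axis_deg _ _ _ _ 1); rewrite d axisdeg1.
  by split; [apply/coord_degE; rewrite db d axisdeg1|rewrite db].
pose t := @Tiling V (theta_squares swap_exchange) v a b.
have head i j (y : L) : (i <= m)%N -> (j <= n)%N ->
    segment l (deg2 i j) y -> rng y = v i j.
  move=> im jn sy; have [|<- _] := segment_cat LF (vP i j im jn) (y' := y).
    by rewrite (fact_deg_idm LF) addr0.
  by rewrite (fact_src_idm LF).
have tail i j p q (y : L) : (i + p <= m)%N -> (j + q <= n)%N ->
    segment l (deg2 i j) y -> deg y = deg2 p q -> src y = v (i + p)%N (j + q)%N.
  move=> im jn sy dy.
  have [|-> _] := segment_cat LF sy (y' := idm (v (i + p)%N (j + q)%N)).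
    by rewrite dy deg2D; exact: vP.
  by rewrite (fact_rng_idm LF).
have ta_edge i j : (i < m)%N -> (j <= n)%N -> is_edge (v i j) (a i j) (v i.+1 j).
  move=> im jn; have [da sa] := aP i j im jn; split=> //.
    by apply: head sa => //; exact: ltnW.
  have /coord_degE := da; rewrite axisdeg0 => da'.
  have := tail i j 1%N 0%N _ _ _ sa da'; rewrite addn0 addn1; exact.
have tb_edge i j : (i <= m)%N -> (j < n)%N -> is_edge (v i j) (b i j) (v i j.+1).
  move=> im jn; have [db sb] := bP i j im jn; split=> //.
    by apply: head sb => //; exact: ltnW.
  have /coord_degE := db; rewrite axisdeg1 => db'.
  have := tail i j 0%N 1%N _ _ _ sb db'; rewrite addn0 addn1; exact.
have tt : tiles m n t.
  split=> // i j im jn.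
  have [da ra sa] := ta_edge i j im (ltnW jn).
  have [db rb sb] := tb_edge i.+1 j im jn.
  have [da' ra' sa'] := ta_edge i j.+1 im jn.
  have [db' rb' sb'] := tb_edge i j (ltnW im) jn.
  have ab : edge_pairs A B (a i j, b i.+1 j) by split=> //; exact: etrans sa (esym rb).
  have ba : edge_pairs B A (b i j, a i j.+1).
    by split=> //; exact: etrans sb' (esym ra').
  split=> //; apply: swap_eq => //=.
  have /coord_degE ea := da; have /coord_degE eb := db.
  have /coord_degE ea' := da'; have /coord_degE eb' := db'.
  rewrite axisdeg0 in ea ea'; rewrite axisdeg1 in eb eb'.
  have [|_ s1] := segment_cat LF (aP i j im (ltnW jn)).2 (y' := val (b i.+1 j)).
    by rewrite ea deg2D addn0 addn1; apply: (bP _ _ _ _).2.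
  have [|_ s2] := segment_cat LF (bP i j (ltnW im) jn).2 (y' := val (a i j.+1)).
    by rewrite eb' deg2D addn0 addn1; apply: (aP _ _ _ _).2.
  apply: segment_uniq s2 s1 _ => //.
  have [_ _ /= e1] := ab; have [_ _ /= e2] := ba.
  by rewrite !(fact_deg_comp LF) // ea eb ea' eb' !deg2D.
have [x [xw xh [xv xa xb]]] := path_of_tiling tt.
exists x; split; rewrite ?deg_path ?xw ?xh //.
- by move=> i j im jn; rewrite xv //; exact: vP.
- by move=> i j im jn; rewrite xa //; exact: (aP _ _ _ _).2.
- by move=> i j im jn; rewrite xb //; exact: (bP _ _ _ _).2.
Qed.

Lemma trace_rng l x : traces l x -> rng l = rng x.
Proof.
move=> tr; rewrite (rng_path swap_exchange); apply: (segment_rng LF).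
by rewrite -deg2_0; exact: trace_v tr _ _ (leq0n _) (leq0n _).
Qed.

Lemma trace_src l x : traces l x -> src l = src x.
Proof.
move=> tr; rewrite (src_path swap_exchange); apply: (segment_src LF).
rewrite (trace_deg tr) deg_path; exact: trace_v tr _ _ (leqnn _) (leqnn _).
Qed.

(** If every segment of [l'] is a segment of [l] shifted by (p, q), then the
    grid of [l'] is a piece of the grid of [l], by uniqueness of segments. *)
Lemma trace_agree l l' p q m n (x z : P) : traces l z -> traces l' x ->
  width x = m -> height x = n -> (p + m <= width z)%N -> (q + n <= height z)%N ->
  (forall i j y, segment l' (deg2 i j) y -> segment l (deg2 (p + i) (q + j)) y) ->
  agree m n (shift p q (pt z)) (pt x).
Proof.
move=> tz tx xw xh pm qn sub; subst m n.
have [za zb _] := tiles_path swap_exchange z.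
have [xa xb _] := tiles_path swap_exchange x.
split=> i j im jn /=.
- have pi : (p + i <= width z)%N by apply: leq_trans pm; rewrite leq_add2l.
  have qj : (q + j <= height z)%N by apply: leq_trans qn; rewrite leq_add2l.
  rewrite -[LHS](fact_rng_idm LF) -[RHS](fact_rng_idm LF); congr rng.
  apply: (segment_uniq LF (trace_v tz pi qj) (sub _ _ _ (trace_v tx im jn))).
  by rewrite !(fact_deg_idm LF).
- have pi : (p + i < width z)%N by apply: leq_trans pm; rewrite ltn_add2l.
  have qj : (q + j <= height z)%N by apply: leq_trans qn; rewrite leq_add2l.
  apply: val_inj.
  apply: (segment_uniq LF (trace_a tz pi qj) (sub _ _ _ (trace_a tx im jn))).
  have [/coord_degE -> _ _] := za _ _ pi qj.
  by have [/coord_degE -> _ _] := xa i j im jn.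
- have pi : (p + i <= width z)%N by apply: leq_trans pm; rewrite leq_add2l.
  have qj : (q + j < height z)%N by apply: leq_trans qn; rewrite ltn_add2l.
  apply: val_inj.
  apply: (segment_uniq LF (trace_b tz pi qj) (sub _ _ _ (trace_b tx im jn))).
  have [/coord_degE -> _ _] := zb _ _ pi qj.
  by have [/coord_degE -> _ _] := xb i j im jn.
Qed.

(** Segments of either factor are segments of the product, so the grid of the
    product is the concatenation of the grids of the factors. *)
Lemma trace_comp l l' x x' z : src l = rng l' ->
  traces l x -> traces l' x' -> traces (comp l l') z -> z = comp x x'.
Proof.
move=> ll' tx tx' tz; apply: (path_concatE (theta_exchange := swap_exchange)).
have := trace_deg tz; rewrite (fact_deg_comp LF) // (trace_deg tx) (trace_deg tx').
rewrite !deg_path deg2D => /esym/deg2_inj[w h].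
split=> //.
  rewrite -[pt z]shift00; apply: (trace_agree tz tx) => //; rewrite ?w ?h ?leq_addr //.
  by move=> i j y; exact: segment_compl.
apply: (trace_agree tz tx') => //; rewrite ?w ?h //.
by move=> i j y; rewrite -deg2D -deg_path -(trace_deg tx); exact: segment_compr.
Qed.

(** An edge is its own only segment of its degree, so its grid has this one
    edge. *)
Lemma trace_hor l x : deg x = deg2 1 0 -> traces l x ->
  val (ta (pt x) 0 0 : A) = l.
Proof.
move=> dx tx; have := dx; rewrite deg_path => /deg2_inj[w h].
have s := trace_a tx (i := 0) (j := 0).
have [xa _ _] := tiles_path swap_exchange x.
rewrite w h deg2_0 in s xa; have [da _ _] := xa 0%N 0%N isT isT.
apply: (segment_uniq LF (s isT isT) (segment_refl LF l)).
have /coord_degE -> := da.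
by rewrite axisdeg0 (trace_deg tx).
Qed.

Lemma trace_ver l x : deg x = deg2 0 1 -> traces l x ->
  val (tb (pt x) 0 0 : B) = l.
Proof.
move=> dx tx; have := dx; rewrite deg_path => /deg2_inj[w h].
have s := trace_b tx (i := 0) (j := 0).
have [_ xa _] := tiles_path swap_exchange x.
rewrite w h deg2_0 in s xa; have [da _ _] := xa 0%N 0%N isT isT.
apply: (segment_uniq LF (s isT isT) (segment_refl LF l)).
have /coord_degE -> := da.
by rewrite axisdeg1 (trace_deg tx).
Qed.

Lemma isomorphic_theta_product : isomorphic L P.
Proof.
have [f fP] : exists f : L -> P, forall l, traces l (f l).
  by exists (fun l => sval (cid (trace_ex l))) => l; case: cid.
have PF : is_factorial P := theta_product_factorial swap_exchange.
have fdeg l : deg (f l) = deg l by rewrite (trace_deg (fP l)).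
apply: (@isomorphic_from_edges _ _ L P f) => //.
- split=> //.
  + by move=> l; rewrite (trace_rng (fP l)).
  + by move=> l; rewrite (trace_src (fP l)).
  + move=> v; have := fdeg (idm v); rewrite (fact_deg_idm LF) => /(deg0_idm PF) ->.
    by rewrite -(trace_rng (fP _)) (fact_rng_idm LF).
  + by move=> x y xy; apply: (trace_comp xy).
- move=> c x y dx dy exy; have fx := fP x; have fy := fP y.
  rewrite -exy in fy; have := fdeg x; rewrite dx.
  case: (unitdeg2 c) => -[_ ->] d.
    by rewrite -(trace_hor d fx) (trace_hor d fy).
  by rewrite -(trace_ver d fx) (trace_ver d fy).
move=> c y dy; case: (unitdeg2 c) => -[_ cE]; rewrite cE in dy.
  exists (val (ta (pt y) 0 0 : A)); set l := val _.
  have := dy; rewrite deg_path => /deg2_inj[w h].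
  have [ya _ _] := tiles_path swap_exchange y; rewrite w h in ya.
  have [/coord_degE dl _ _] := ya 0%N 0%N isT isT; rewrite axisdeg0 in dl.
  have dfl : deg (f l) = deg2 1 0 by rewrite fdeg.
  have := dfl; rewrite deg_path => /deg2_inj[w' h'].
  apply: (hor_path_inj (theta_exchange := swap_exchange)) => //; first by rewrite dy.
  by apply: val_inj; rewrite (trace_hor dfl (fP l)).
exists (val (tb (pt y) 0 0 : B)); set l := val _.
have := dy; rewrite deg_path => /deg2_inj[w h].
have [_ ya _] := tiles_path swap_exchange y; rewrite w h in ya.
have [/coord_degE dl _ _] := ya 0%N 0%N isT isT; rewrite axisdeg1 in dl.
have dfl : deg (f l) = deg2 0 1 by rewrite fdeg.
have := dfl; rewrite deg_path => /deg2_inj[w' h'].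
apply: (ver_path_inj (theta_exchange := swap_exchange)) => //; first by rewrite dy.
by apply: val_inj; rewrite (trace_ver dfl (fP l)).
Qed.

End Exchange.

Theorem mainTheorem13 :
  (forall (V : countType) (A B : kgraph 1 V) (theta : A * B -> B * A),
     vertex_matrices_commute A B -> is_edge_exchange theta ->
     (forall (m n m' n' : nat) (x : grid theta m n) (x' : grid theta m' n'),
        gridv x ord_max ord_max = gridv x' ord0 ord0 ->
        exists! y : grid theta (m + m') (n + n'), is_concat x x' y) /\
     is_kgraph (theta_product theta)) /\
  (forall (V : countType) (L : kgraph 2 V),
     let A := coordinate_graph L ord0 in
     let B := coordinate_graph L ord_max in
     [/\ is_kgraph A, is_kgraph B, vertex_matrices_commute A B &
         exists theta : A * B -> B * A,
           is_edge_exchange theta /\ isomorphic L (theta_product theta)]).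
Proof.
split=> [V A B theta _ theta_exchange|V L A B].
  split; first by move=> *; apply: concat_unique.
  by apply: theta_product_kgraph => //; exact: kgraphP.
have AG : is_kgraph A := coordinate_graphP L ord0.
have BG : is_kgraph B := coordinate_graphP L ord_max.
split=> //; first exact: edge_exchange_commute AG BG (swap_exchange L).
by exists (@swap V L); split; [exact: swap_exchange|exact: isomorphic_theta_product].
Qed.
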